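(* Let $\{X_n\}$ be the (2-2) random walk with non-homogeneous transition probabilities $\omega$, started from $X_0=0$, with $\limsup_{n\to\infty}X_n=\infty$ ($P_\omega^0$-a.s.), and let $U_i$, $i\le 1$, be the excursion-count vectors defined in the context. Then $\{U_i\}_{i\le 1}$ (with generations indexed in the order $i=1,0,-1,-2,\dots$) is a 9-type non-homogeneous branching process whose immigration law and offspring laws are as follows. Here $\mathbf e_l$ is the $l$-th standard basis row vector of $\mathbb{R}^9$, and for $i\le0$ and $a,b,c,d\in\{0,1,2,\dots\}$ $$\pi_i(a,b,c,d)=\frac{(a+b+c+d)!}{a!\,b!\,c!\,d!}\,\alpha_{i,1}^a\alpha_{i,2}^b\beta_{i,1}^c\beta_{i,2}^d\,(1-\alpha_{i,1}-\alpha_{i,2}-\beta_{i,1}-\beta_{i,2}).$$ Immigration: with $d_1=1-\omega_0(-1)f_{-1}(-1,0)-\omega_0(-2)f_{-2}(-1,0)$, $$P_\omega^0(U_1=\mathbf e_1)=\frac{\omega_0(1)}{d_1},\quad P_\omega^0(U_1=\mathbf e_3)=\frac{\omega_0(2)}{d_1},\quad P_\omega^0(U_1=\mathbf e_2)=\frac{d_1-\omega_0(1)-\omega_0(2)}{d_1}.$$ Offspring, for $i\le 0$ and all $a,b,c,d\ge0$: (a) for $l\in\{1,3,7,9\}$ (particles $\mathcal A_{i+1,1},\mathcal A_{i+1,3},\mathcal C_{i+1,1},\mathcal C_{i+1,3}$): $$P_\omega^0(U_i=(a,b,0,c,d,0,0,0,0)\mid U_{i+1}=\mathbf e_l)=\pi_i(a,b,c,d).$$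 (b) for $l\in\{2,8\}$ (particles $\mathcal A_{i+1,2},\mathcal C_{i+1,2}$): $$P_\omega^0(U_i=(a,b,1,c,d,0,0,0,0)\mid U_{i+1}=\mathbf e_l)=\pi_i(a,b,c,d)\frac{\alpha_{i,3}}{\alpha_{i,3}+\beta_{i,3}},$$ $$P_\omega^0(U_i=(a,b,0,c,d,1,0,0,0)\mid U_{i+1}=\mathbf e_l)=\pi_i(a,b,c,d)\frac{\beta_{i,3}}{\alpha_{i,3}+\beta_{i,3}}.$$ (c) for $l\in\{4,6\}$ (particles $\mathcal B_{i+1,1},\mathcal B_{i+1,3}$): $$P_\omega^0(U_i=(a,b,0,c,d,0,1,0,0)\mid U_{i+1}=\mathbf e_l)=\pi_i(a,b,c,d)\frac{\gamma_{i,1}}{\gamma_{i,1}+\gamma_{i,2}},$$ $$P_\omega^0(U_i=(a,b,0,c,d,0,0,1,0)\mid U_{i+1}=\mathbf e_l)=\pi_i(a,b,c,d)\frac{\gamma_{i,2}}{\gamma_{i,1}+\gamma_{i,2}}.$$ (d) for $l=5$ (particle $\mathcal B_{i+1,2}$): $$P_\omega^0(U_i=(0,0,0,0,0,0,0,0,1)\mid U_{i+1}=\mathbf e_5)=\frac{\gamma_{i,3}}{\beta_{i+1,2}},$$ and, writing $\kappa_i=\dfrac{\beta_{i+1,2}-\gamma_{i,3}}{\beta_{i+1,2}(\gamma_{i,1}+\gamma_{i,2})(\alpha_{i,3}+\beta_{i,3})}$, $$P_\omega^0(U_i=(a,b,1,c,d,0,1,0,0)\mid U_{i+1}=\mathbf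 e_5)=\pi_i(a,b,c,d)\,\kappa_i\gamma_{i,1}\alpha_{i,3},$$ $$P_\omega^0(U_i=(a,b,1,c,d,0,0,1,0)\mid U_{i+1}=\mathbf e_5)=\pi_i(a,b,c,d)\,\kappa_i\gamma_{i,2}\alpha_{i,3},$$ $$P_\omega^0(U_i=(a,b,0,c,d,1,1,0,0)\mid U_{i+1}=\mathbf e_5)=\pi_i(a,b,c,d)\,\kappa_i\gamma_{i,1}\beta_{i,3},$$ $$P_\omega^0(U_i=(a,b,0,c,d,1,0,1,0)\mid U_{i+1}=\mathbf e_5)=\pi_i(a,b,c,d)\,\kappa_i\gamma_{i,2}\beta_{i,3}.$$
   Context: The (2-2) random walk: for each $i\in\mathbb{Z}$ let $\omega_i=(\omega_i(-2),\omega_i(-1),\omega_i(1),\omega_i(2))$ be a probability vector, and $\omega=\{\omega_i\}_{i\in\mathbb{Z}}$. $\{X_n\}_{n\ge0}$ is the Markov chain on $\mathbb{Z}$ with $P_\omega(X_{n+1}=i+j\mid X_n=i)=\omega_i(j)$, $j\in\{-2,-1,1,2\}$; $P_\omega^x$ is its law when $X_0=x$. $T_1=\inf\{n\ge 0:X_n>0\}$. Excursions at $i$. An excursion at $i$ is a path segment $X_k,X_{k+1},\dots,X_{k+l},X_{k+l+1}$ with $l\ge 1$, $X_{k+1},\dots,X_{k+l}\le i-1$, $X_{k+l+1}\ge i$, and with first step: type $\mathcal{A}$ at $i$: $X_k=i$, $X_{k+1}=i-1$; type $\mathcal{B}$ at $i$: $X_k=i$, $X_{k+1}=i-2$; type $\mathcal{C}$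 at $i$: $X_k=i+1$, $X_{k+1}=i-1$. Each type has three sub-types according to its last step: sub-type 1 if the last step is $\{i-1\to i\}$, sub-type 2 if it is $\{i-2\to i\}$, sub-type 3 if it is $\{i-1\to i+1\}$. These are denoted $\mathcal{A}_{i,j},\mathcal{B}_{i,j},\mathcal{C}_{i,j}$, $j=1,2,3$. For $i\le 0$, $A_{i,j},B_{i,j},C_{i,j}$ are the numbers of $\mathcal{A}_{i,j},\mathcal{B}_{i,j},\mathcal{C}_{i,j}$ excursions before $T_1$ (an excursion whose last step is the step made at time $T_1$ is counted), and $$U_i=(A_{i,1},A_{i,2},A_{i,3},B_{i,1},B_{i,2},B_{i,3},C_{i,1},C_{i,2},C_{i,3}).$$ The ancestor (immigration) $U_1$: one adds an imaginary step from $1$ to $0$ before time $0$, i.e. sets $X_{-1}=1$. The path $\{X_{-1}=1,X_0=0,X_1,\dots,X_{T_1}\}$ is then a type-$\mathcal A$ excursion at $1$, and $U_1$ is defined by the same formula with $i=1$ for this extended path; so $A_{1,1}+A_{1,2}+A_{1,3}=1$ and all $B_{1,j}=C_{1,j}=0$, i.e. $U_1\in\{\mathbf e_1,\mathbf e_2,\mathbf e_3\}$. Non-homogeneous multitype branching process: $(U_1,U_0,U_{-1},\dots)$ is a Markov chain such that, given $U_{i+1}=(u_1,\dots,u_9)$, $U_i$ is distributed as the sum of $u_1+\dots+u_9$ independent random vectors, exactly $u_l$ of which have the offspring law of a type-$l$ particle of generation $i+1$; the offspring law of type $l$ is the conditional law of $U_i$ given $U_{i+1}=\mathbf e_l$.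 The order of types is that of the coordinates of $U_i$. Hitting probabilities: for $k\le i<j$, $f_k(i,j)=P_\omega^k(\text{the walk hits }(i,\infty)\text{ from below at }j)$, i.e. the first visited point of $(i,\infty)$ is $j$ (so $j\in\{i+1,i+2\}$). Indices: for $i\in\mathbb Z$ put $d_i=1-\omega_{i-1}(-1)f_{i-2}(i-2,i-1)-\omega_{i-1}(-2)f_{i-3}(i-2,i-1)$ and $$\alpha_{i,1}=\frac{\omega_i(-1)\omega_{i-1}(1)}{d_i},\quad \alpha_{i,3}=\frac{\omega_i(-1)\omega_{i-1}(2)}{d_i},\quad \alpha_{i,2}=\omega_i(-1)-\alpha_{i,1}-\alpha_{i,3},$$ $$\beta_{i,1}=\frac{\omega_i(-2)f_{i-2}(i-2,i-1)\omega_{i-1}(1)}{d_i},\quad \beta_{i,3}=\frac{\omega_i(-2)f_{i-2}(i-2,i-1)\omega_{i-1}(2)}{d_i},\quad \beta_{i,2}=\omega_i(-2)-\beta_{i,1}-\beta_{i,3},$$ $$\gamma_{i,1}=\frac{\omega_{i+1}(-2)\omega_{i-1}(1)}{d_i},\quad \gamma_{i,3}=\frac{\omega_{i+1}(-2)\omega_{i-1}(2)}{d_i},\quad \gamma_{i,2}=\omega_{i+1}(-2)-\gamma_{i,1}-\gamma_{i,3}.$$ Offspring laws of particle types that occur with probability $0$ are irrelevant (formulas with vanishing denominators then carry no content). *)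

(* Defs.v *)
From HB Require Import structures.
From mathcomp Require Export all_boot all_order all_algebra.
From mathcomp Require Export all_classical all_reals all_analysis.

Set Implicit Arguments.
Unset Strict Implicit.
Unset Printing Implicit Defensive.

Import Order.TTheory GRing.Theory Num.Theory.

Local Open Scope classical_set_scope.
Local Open Scope ring_scope.

(* P(A | B); equals 0 when P(B) = 0, so every use is guarded by 0 < P(B) *)
Definition cprob d (T : measurableType d) (R : realType)
    (P : probability T R) (A B : set T) : R :=
  fine (P (A `&` B)) / fine (P B).

(* the event {Z_0 = h 0, ..., Z_n = h n} *)
Definition history (T S : Type) (Z : nat -> T -> S) (n : nat) (h : nat -> S) :
    set T :=
  [set t | forall k, (k <= n)%N -> Z k t = h k].

Definition steps : seq int := [:: -2; -1; 1; 2].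

(* [w i j] is omega_i(j); its values for j outside [steps] are never used *)
Definition environment (R : realType) (w : int -> int -> R) : Prop :=
  forall i, (forall j, j \in steps -> 0 <= w i j) /\
            \sum_(j <- steps) w i j = 1.

(* [P x] is the quenched law of the walk started at x *)
Definition random_walk d (T : measurableType d) (R : realType)
    (w : int -> int -> R) (P : int -> probability T R) (X : nat -> T -> int) :
    Prop :=
  [/\ forall n y, measurable (X n @^-1` [set y]),
      forall x, P x (X 0 @^-1` [set x]) = 1%E
    & forall x n (h : nat -> int) j, j \in steps ->
        (0 < P x (history X n h))%E ->
        cprob (P x) (X n.+1 @^-1` [set h n + j]) (history X n h) = w (h n) j].

(* f_k(i, j), meant for k <= i *)
Definition hitting_prob d (T : measurableType d) (R : realType)
    (P : int -> probability T R) (X : nat -> T -> int) (k i j : int) : R :=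
  fine (P k [set t | i < j /\ exists n : nat,
                       X n t = j /\ forall m, (m < n)%N -> X m t <= i]).

(* T_1 of a path; the value 0 is a dummy when the path never becomes positive *)
Definition hit_pos (x : nat -> int) : nat :=
  if pselect (exists n, 0 < x n) is left ex then ex_minn ex else 0%N.

(* x_k, ..., x_(k+l+1) is an excursion at i with the given first and last
   steps, a step y -> z being the pair (y, z) *)
Definition is_excursion (x : nat -> int) (i : int) (first last : int * int)
    (k l : nat) : bool :=
  [&& (0 < l)%N, all (fun m => x m <= i - 1) (iota k.+1 l), i <= x (k + l).+1,
      (x k, x k.+1) == first & (x (k + l)%N, x (k + l).+1) == last].

(* number of such excursions which are completed by time N *)
Definition nb_excursions (x : nat -> int) (N : nat) (i : int)
    (first last : int * int) : nat :=
  #|[set kl : 'I_N * 'I_N |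
      is_excursion x i first last kl.1 kl.2 && ((kl.1 + kl.2).+1 <= N)%N]%SET|.

Definition row9 (s : seq nat) : 'rV[nat]_9 := \row_(j < 9) nth 0%N s j.

Definition excursion_vector (x : nat -> int) (N : nat) (i : int) :
    'rV[nat]_9 :=
  let firstA := (i, i - 1) in
  let firstB := (i, i - 2) in
  let firstC := (i + 1, i - 1) in
  let last1 := (i - 1, i) in
  let last2 := (i - 2, i) in
  let last3 := (i - 1, i + 1) in
  let nb := nb_excursions x N i in
  row9 [:: nb firstA last1; nb firstA last2; nb firstA last3;
           nb firstB last1; nb firstB last2; nb firstB last3;
           nb firstC last1; nb firstC last2; nb firstC last3].

(* the path with the imaginary step 1 -> x_0 put in front; times are shifted
   by one *)
Definition extended_path (x : nat -> int) (n : nat) : int :=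
  if n is m.+1 then x m else 1.

(* U_i, meant for i <= 1 *)
Definition U_of_path (x : nat -> int) (i : int) : 'rV[nat]_9 :=
  if i == 1 then excursion_vector (extended_path x) (hit_pos x).+1 1
  else excursion_vector x (hit_pos x) i.

Definition excursion_counts (T : Type) (X : nat -> T -> int) (i : int) (t : T) :
    'rV[nat]_9 :=
  U_of_path (fun n => X n t) i.

Definition pmf (V : choiceType) (R : realType) (q : V -> R) : Prop :=
  (forall v, 0 <= q v) /\ (\esum_(v in [set: V]) (q v)%:E = 1)%E.

(* Law of the sum of independent random vectors, one for each element (l, _)
   of {l & 'I_(u l)}, the one of (l, _) having law p l. *)
Definition offspring_sum_law K (R : realType) (p : 'I_K -> 'rV[nat]_K -> R)
    (u v : 'rV[nat]_K) : \bar R :=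
  (\esum_(x in [set x : {ffun {l : 'I_K & 'I_(u ord0 l)} -> 'rV[nat]_K} |
                 (\sum_k x k)%R = v])
     (\prod_k p (tag k) (x k))%R%:E)%E.

(* [p n l] is the offspring law of the particles of type l of generation n *)
Definition branching_process d (T : measurableType d) (R : realType)
    (P : probability T R) K (Z : nat -> T -> 'rV[nat]_K)
    (p : nat -> 'I_K -> 'rV[nat]_K -> R) : Prop :=
  [/\ forall n v, measurable (Z n @^-1` [set v]),
      forall n l, pmf (p n l),
      forall n (h : nat -> 'rV[nat]_K) v,
        (0 < P (history Z n h))%E ->
        (cprob P (Z n.+1 @^-1` [set v]) (history Z n h))%:E =
          offspring_sum_law (p n) (h n) v
    & forall n l v,
        (0 < P (Z n @^-1` [set delta_mx ord0 l]))%E ->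
        p n l v =
          cprob P (Z n.+1 @^-1` [set v]) (Z n @^-1` [set delta_mx ord0 l])].

(* [f k i j] stands for the hitting probability f_k(i, j) *)

Section Indices.
Context {R : realType} (w : int -> int -> R) (f : int -> int -> int -> R).

Definition d_ (i : int) : R :=
  1 - w (i - 1) (-1) * f (i - 2) (i - 2) (i - 1)
    - w (i - 1) (-2) * f (i - 3) (i - 2) (i - 1).

Definition alpha1 i : R := w i (-1) * w (i - 1) 1 / d_ i.
Definition alpha3 i : R := w i (-1) * w (i - 1) 2 / d_ i.
Definition alpha2 i : R := w i (-1) - alpha1 i - alpha3 i.

Definition beta1 i : R :=
  w i (-2) * f (i - 2) (i - 2) (i - 1) * w (i - 1) 1 / d_ i.
Definition beta3 i : R :=
  w i (-2) * f (i - 2) (i - 2) (i - 1) * w (i - 1) 2 / d_ i.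
Definition beta2 i : R := w i (-2) - beta1 i - beta3 i.

Definition gamma1 i : R := w (i + 1) (-2) * w (i - 1) 1 / d_ i.
Definition gamma3 i : R := w (i + 1) (-2) * w (i - 1) 2 / d_ i.
Definition gamma2 i : R := w (i + 1) (-2) - gamma1 i - gamma3 i.

Definition pi_ (i : int) (a b c d : nat) : R :=
  ((a + b + c + d)`!)%:R / (a`! * b`! * c`! * d`!)%:R *
  alpha1 i ^+ a * alpha2 i ^+ b * beta1 i ^+ c * beta2 i ^+ d *
  (1 - alpha1 i - alpha2 i - beta1 i - beta2 i).

Definition kappa (i : int) : R :=
  (beta2 (i + 1) - gamma3 i) /
  (beta2 (i + 1) * (gamma1 i + gamma2 i) * (alpha3 i + beta3 i)).

(* [q] is the law of U_i for one parent of type l + 1: the ordinal l starts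
   from 0, whereas [l.+1] is the number of the type. *)
Definition offspring_formulas (i : int) (l : 'I_9) (q : 'rV[nat]_9 -> R) :
    Prop :=
  [/\ l.+1 \in [:: 1; 3; 7; 9]%N -> forall a b c d : nat,
        q (row9 [:: a; b; 0; c; d; 0; 0; 0; 0]%N) = pi_ i a b c d,
      l.+1 \in [:: 2; 8]%N -> forall a b c d : nat,
        q (row9 [:: a; b; 1; c; d; 0; 0; 0; 0]%N) =
          pi_ i a b c d * (alpha3 i / (alpha3 i + beta3 i)) /\
        q (row9 [:: a; b; 0; c; d; 1; 0; 0; 0]%N) =
          pi_ i a b c d * (beta3 i / (alpha3 i + beta3 i)),
      l.+1 \in [:: 4; 6]%N -> forall a b c d : nat,
        q (row9 [:: a; b; 0; c; d; 0; 1; 0; 0]%N) =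
          pi_ i a b c d * (gamma1 i / (gamma1 i + gamma2 i)) /\
        q (row9 [:: a; b; 0; c; d; 0; 0; 1; 0]%N) =
          pi_ i a b c d * (gamma2 i / (gamma1 i + gamma2 i))
    & l.+1 = 5%N ->
        q (row9 [:: 0; 0; 0; 0; 0; 0; 0; 0; 1]%N) = gamma3 i / beta2 (i + 1) /\
        forall a b c d : nat,
        [/\ q (row9 [:: a; b; 1; c; d; 0; 1; 0; 0]%N) =
              pi_ i a b c d * (kappa i * gamma1 i * alpha3 i),
            q (row9 [:: a; b; 1; c; d; 0; 0; 1; 0]%N) =
              pi_ i a b c d * (kappa i * gamma2 i * alpha3 i),
            q (row9 [:: a; b; 0; c; d; 1; 1; 0; 0]%N) =
              pi_ i a b c d * (kappa i * gamma1 i * beta3 i)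
          & q (row9 [:: a; b; 0; c; d; 1; 0; 1; 0]%N) =
              pi_ i a b c d * (kappa i * gamma2 i * beta3 i)]].

End Indices.

(* Main.v *)
(* Cut at level c, a path splits uniquely into blocks, each ending at its first
   point above c. The blocks that go below c are the excursions at level c + 1;
   replacing each of them by its first point and its last step leaves a
   skeleton which determines all excursion counts at levels > c. Path weights
   are multiplicative along blocks, so given the skeleton the blocks are
   independent and the law of a block depends only on its type: this is the
   branching property. A single block starting at level i is cut again, at
   level i - 1. Splitting off its first sub-block gives linear equations for
   the exit masses, which identify the indices alpha, beta and gamma, and the
   Pascal recursion of the multinomial coefficients for the offspring laws.
   Summing over words of integers replaces conditioning throughout; the
   hypothesis on limsup enters only through the total mass 1 of the words from
   0 to their first positive point. *)
From mathcomp Require Import zify ring lra.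
Require Import Defs.
Import Order.TTheory GRing.Theory Num.Theory.
Local Open Scope classical_set_scope.
Local Open Scope ring_scope.
Set Implicit Arguments.
Unset Strict Implicit.
Unset Printing Implicit Defensive.

(** * Sums over countable index sets *)

(** The formulas divide by [d_] and by sums of indices, while the environment at sites that the walk
    never visits is arbitrary, so that the denominators may vanish there. The predicate [reach]
    controls this: it says that the words from a site to their first positive point have total mass
    1, and it is passed on along steps of positive weight. Index identities are asserted under the
    alternative that a prefactor vanishes or the relevant site has [reach]. Exit masses satisfy
    equations of the form mass * (1 - ret) = base, solved only where 1 - ret is known to be nonzero.
    In the conditional law of a type the weight of the first step is cancelled beforehand, so only
    the mass of the remaining excursion has to be positive. The branching identity is stated for
    test functions [Phi] of the skeleton rather than for events, because this form is stable under
    cutting off the first block; the induction is on the number of points above the level. *)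

Section Esum.
Context {R : realType}.
Implicit Types (T U : choiceType).

Lemma esum_ge_term T (S : set T) (a : T -> \bar R) x :
  (forall i, S i -> 0 <= a i)%E -> S x -> (a x <= \esum_(i in S) a i)%E.
Proof.
move=> a0 Sx; apply: esum_ge; exists [set x].
  by split=> [|i ->]; first exact: finite_set1.
by rewrite fsbig_set1.
Qed.

Lemma esum_gt0 T (S : set T) (a : T -> \bar R) :
  (forall i, S i -> 0 <= a i)%E -> (0 < \esum_(i in S) a i)%E ->
  exists2 x, S x & (0 < a x)%E.
Proof.
move=> a0 pos; apply: contrapT => no; move: pos.
rewrite esum1 ?ltxx// => i Si; apply/eqP; rewrite eq_le a0// andbT leNgt.
by apply/negP => ai; apply: no; exists i.
Qed.

(** Infinite values are allowed, so scaling a supremum covers only finite [k]. The case of a zero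
    sum is split off first, because of products of 0 and [+oo]. *)
Lemma esum_cmul T (S : set T) (k : \bar R) (a : T -> \bar R) :
  (0 <= k)%E -> (forall i, S i -> 0 <= a i)%E ->
  (\esum_(i in S) (k * a i) = k * \esum_(i in S) a i)%E.
Proof.
move=> k0 a0.
have [s0|spos] := eqVneq (\esum_(i in S) a i)%E 0%E.
  rewrite s0 mule0 esum1// => i Si.
  have : (a i <= 0)%E by rewrite -s0; exact: esum_ge_term.
  by move=> ai; rewrite (_ : a i = 0%E) ?mule0//; apply/eqP; rewrite eq_le ai
    a0.
have {spos} [x Sx ax] : exists2 x, S x & (0 < a x)%E.
  by apply: esum_gt0 => //; rewrite lt_def spos esum_ge0.
case: k k0 => [r r0| _ |//].
  rewrite /esum -ereal_supZl//; last first.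
    by apply/set0P; exists 0%E; exists set0;
      [exact: fsets_set0|rewrite fsbig_set0].
  rewrite image_comp; congr ereal_sup; apply: eq_imagel => A [_ AS] /=.
  rewrite (eq_fsbigr (fun i => r%:E * (if i \in S then a i else 0)))%E.
    rewrite -ge0_mule_fsumr; last by move=> i; case: ifPn => // /set_mem/a0.
    by congr (_ * _)%E; apply: eq_fsbigr => i /set_mem/AS iS; rewrite mem_set.
  by move=> i /set_mem/AS iS; rewrite mem_set.
(* Here [k] is [+oo]: the single positive term [a x] already makes both sides infinite. *)
have e1 : (\esum_(i in S) a i)%E != 0%E.
  by rewrite gt_eqF//; apply: lt_le_trans ax _; exact: esum_ge_term.
rewrite gt0_mulye ?lt_def ?e1 ?esum_ge0//.
apply/eqP; rewrite eq_le leey/= -[leLHS](gt0_mulye ax).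
by apply: (esum_ge_term (a := fun i => +oo * a i)%E) => // i /a0; apply:
  mule_ge0.
Qed.

Lemma esum_swap T U (S : set T) (V : set U) (a : T -> U -> \bar R) :
  (forall i j, S i -> V j -> 0 <= a i j)%E ->
  (\esum_(i in S) \esum_(j in V) a i j = \esum_(j in V) \esum_(i in S) a i j)%E.
Proof.
move=> a0; rewrite !esum_esum//; last by move=> i j *; exact: a0.
rewrite (reindex_esum (V `*`` fun=> S) _ (fun x => (x.2, x.1)))//; split=> //=.
- by move=> [i j] [].
- by move=> [i j] [i' j'] /= _ _ [-> ->].
- by move=> [i j] [/= ? ?]; exists (j, i).
Qed.

(** Read from right to left, this splits a quantity according to the value [u] of some statistic of
    the word. *)
Lemma esum_pick T (u : T) (a : T -> \bar R) : (forall i, 0 <= a i)%E ->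
  (\esum_(j in [set: T]) (if u == j then a j else 0) = a u)%E.
Proof.
move=> a0; rewrite -[RHS]esum_set1// [RHS]esum_mkcond; apply: eq_esum => j _.
by rewrite in_set1 eq_sym.
Qed.

End Esum.

(** * Weighted words *)

(** The starting point is not a letter of the word. Blocks then concatenate without overlap, and the
    start may lie above [c] as well. *)
Fixpoint block (c : int) (s : seq int) : bool :=
  if s is z :: s' then if c < z then s' == [::] else block c s' else false.

(* The step by which a path started at [x] first jumps above [c]. *)
Fixpoint exit_step (c x : int) (s : seq int) : option (int * int) :=
  if s is z :: s' then if c < z then Some (x, z) else exit_step c z s'
  else None.

Lemma block_last c x s : block c s -> c < last x s.
Proof.
elim: s x => //= z s IH x; case: ifP => [cz /eqP -> //|_]; exact: IH.
Qed.

Lemma block_exit c x s : block c s ->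
  exists y, [/\ exit_step c x s = Some (y, last x s)
    & (x <= c -> y <= c)].
Proof.
elim: s x => //= z s IH x; case: ifP => [cz /eqP -> |cz /(IH z)[y [-> h]]].
  by exists x.
by exists y; split=> // _; apply: h; rewrite leNgt cz.
Qed.

Lemma exit_last c x s e : block c s -> exit_step c x s = Some e -> last x s =
  e.2.
Proof. by move=> /(@block_exit _ x)[y [-> _]] [<-]. Qed.

Section Words.
Context {R : realType} (w : int -> int -> R).

Fixpoint weight (x : int) (s : seq int) : R :=
  if s is z :: s' then
    (if z - x \in steps then w x (z - x) else 0) * weight z s'
  else 1.

(** The expectation of [F] at the path up to its first later time above [c], restricted to the event
    that this time is finite; the total mass may be less than 1. *)
Definition block_sum (c x : int) (F : seq int -> \bar R) : \bar R :=
  \esum_(s in [set s | block c s]) ((weight x s)%:E * F s)%E.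

Local Notation BS := block_sum.

Lemma weight_cat x s s' : weight x (s ++ s') = weight x s * weight (last x s)
  s'.
Proof. by elim: s x => [|z s IH] x /=; rewrite ?mul1r// IH mulrA. Qed.

Hypothesis w_env : environment w.

Lemma step_ge0 x j : j \in steps -> 0 <= w x j.
Proof. by have [h _] := w_env x; apply: h. Qed.

Lemma weight_ge0 x s : 0 <= weight x s.
Proof.
elim: s x => //= z s IH x; apply: mulr_ge0 => //.
by case: ifP => // /step_ge0.
Qed.

Lemma weight_ge0E x s : (0 <= (weight x s)%:E)%E.
Proof. by rewrite lee_fin weight_ge0. Qed.

Lemma BS_ge0 c x F : (forall s, 0 <= F s)%E -> (0 <= BS c x F)%E.
Proof. by move=> F0; apply: esum_ge0 => s _; rewrite mule_ge0 ?weight_ge0E. Qed.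

Lemma eq_BS c x F G :
  (forall s, block c s -> 0 < weight x s -> F s = G s) -> BS c x F = BS c x G.
Proof.
move=> FG; apply: eq_esum => s bs.
have [wx|wx] := ltP 0 (weight x s); first by rewrite FG.
suff -> : weight x s = 0 by rewrite !mul0e.
by apply/eqP; rewrite eq_le wx weight_ge0.
Qed.

Lemma le_BS c x F G : (forall s, 0 <= F s)%E ->
  (forall s, block c s -> (0 < weight x s)%R -> F s <= G s)%E -> (BS c x F <=
    BS c x G)%E.
Proof.
move=> F0 FG; apply: le_esum => s bs.
have [wx|wx] := ltP 0 (weight x s).
  by apply: lee_pmul => //; [exact: weight_ge0E|exact: FG].
suff -> : weight x s = 0 by rewrite !mul0e.
by apply/eqP; rewrite eq_le wx weight_ge0.
Qed.

Lemma BSZ c x k F : (0 <= k)%E -> (forall s, 0 <= F s)%E ->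
  BS c x (fun s => k * F s)%E = (k * BS c x F)%E.
Proof.
move=> k0 F0; rewrite /BS -esum_cmul//.
  by apply: eq_esum => s _; rewrite muleCA.
by move=> s _; rewrite mule_ge0 ?weight_ge0E.
Qed.

Lemma BSD c x F G : (forall s, 0 <= F s)%E -> (forall s, 0 <= G s)%E ->
  BS c x (fun s => F s + G s)%E = (BS c x F + BS c x G)%E.
Proof.
move=> F0 G0; rewrite /BS -esumD//.
- by apply: eq_esum => s _; rewrite ge0_muleDr.
- by move=> s _; rewrite mule_ge0 ?weight_ge0E.
- by move=> s _; rewrite mule_ge0 ?weight_ge0E.
Qed.

Lemma BS_sum c x (I : Type) (r : seq I) (F : I -> seq int -> \bar R) :
  (forall i s, 0 <= F i s)%E ->
  BS c x (fun s => \sum_(i <- r) F i s)%E = (\sum_(i <- r) BS c x (F i))%E.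
Proof.
move=> F0; elim: r => [|i r IH].
  by rewrite big_nil /BS esum1// => s _; rewrite big_nil mule0.
rewrite big_cons -IH -BSD//; last by move=> s; exact: sume_ge0.
by apply: eq_BS => s _ _; rewrite big_cons.
Qed.

Lemma BS_esum c x (T : choiceType) (S : set T) (F : T -> seq int -> \bar R) :
  (forall i s, 0 <= F i s)%E ->
  BS c x (fun s => \esum_(i in S) F i s)%E = (\esum_(i in S) BS c x (F i))%E.
Proof.
move=> F0; rewrite /BS esum_swap; last first.
  by move=> i s _ _; rewrite mule_ge0 ?weight_ge0E.
by apply: eq_esum => s _; rewrite esum_cmul ?weight_ge0E.
Qed.

Lemma esum_steps x (a : int -> \bar R) : (forall z, 0 <= a z)%E ->
  (forall z, z - x \notin steps -> a z = 0%E) ->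
  (\esum_(z in [set: int]) a z = \sum_(j <- steps) a (x + j)%R)%E.
Proof.
move=> a0 az; pose r := [seq x + j | j <- steps].
transitivity (\esum_(z in [set` r]) a z)%E.
  rewrite [RHS]esum_mkcond; apply: eq_esum => z _; case: ifPn => // zr.
  apply: az; apply: contra zr => zx; rewrite inE/=; apply/mapP.
  by exists (z - x) => //; rewrite subrKC.
rewrite esum_fset//; last exact: finite_seq.
rewrite -fsbig_seq; last by rewrite map_inj_uniq //; exact: addrI.
by rewrite big_map.
Qed.

Lemma esum_block_cons c (a : seq int -> \bar R) : (forall s, 0 <= a s)%E ->
  (\esum_(s in [set s | block c s]) a s =
   \esum_(z in [set: int]) (if c < z then a [:: z] else
     \esum_(s in [set s | block c s]) a (z :: s))%R)%E.
Proof.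
move=> a0.
rewrite (reindex_esum ([set: int] `*`` (fun z => [set s | block c (z :: s)])) _
   (fun p => p.1 :: p.2)); last first.
  split=> /=.
  - by move=> [z s] [].
  - by move=> [z s] [z' s'] /= _ _ [-> ->].
  - by move=> [//|z s] /= bs; exists (z, s).
rewrite -(esum_esum (a := fun z s => a (z :: s)))//.
apply: eq_esum => z _ /=; case: ifP => // cz.
rewrite -[RHS](esum_set1 (t := [::]) (a := fun s => a (z :: s)))//.
by congr esum; apply/seteqP; split=> s /= /eqP.
Qed.

Lemma BS_step c x F : (forall s, 0 <= F s)%E ->
  BS c x F = (\sum_(j <- steps) (w x j)%:E *
    (if c < x + j then F [:: x + j] else BS c (x + j) (fun s => F (x + j ::
      s)))%R)%E.
Proof.
move=> F0; rewrite /BS esum_block_cons; last first.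
  by move=> s; rewrite mule_ge0 ?weight_ge0E.
rewrite (@esum_steps x).
- apply: eq_big_seq => j js.
  have xj : x + j - x = j by rewrite addrAC subrr add0r.
  case: ifP => _ /=; first by rewrite xj js mulr1.
  rewrite -esum_cmul ?lee_fin ?step_ge0//; last first.
    by move=> s _; rewrite mule_ge0 ?weight_ge0E.
  by apply: eq_esum => s _; rewrite xj js EFinM muleA.
- move=> z; case: ifP => _; first by rewrite mule_ge0 ?weight_ge0E.
  by apply: esum_ge0 => s _; rewrite mule_ge0 ?weight_ge0E.
- move=> z /negbTE zx; case: ifP => _; first by rewrite /= zx mul0r mul0e.
  by rewrite esum1// => s _; rewrite /= zx mul0r mul0e.
Qed.

Lemma block_cut c' c b s : c' <= c -> block c' b ->
  block c (b ++ s) = if c < last 0 b then s == [::] else block c s.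
Proof.
(* The default of [last] must vary in the induction: in the tail it becomes the letter just
   removed. *)
move=> cc'; elim: b (0 : int) => //= z b IH y.
case: (ltP c' z) => c'z.
  by move=> /eqP -> /=; case: ifP.
by move=> /(IH z) <-; rewrite ltNge (le_trans c'z cc').
Qed.

Lemma block_split c' c s : c' <= c -> block c s ->
  exists b s', block c' b /\ s = b ++ s'.
Proof.
move=> cc'; elim: s => //= z s IH; case: (ltP c' z) => c'z.
  by move=> _; exists [:: z], s; rewrite /= c'z.
rewrite ltNge (le_trans c'z cc')/= => /IH[b [s' [bb ->]]].
by exists (z :: b), s'; rewrite /= ltNge c'z/=.
Qed.

Lemma block_cat_inj c b b' s s' : block c b -> block c b' ->
  b ++ s = b' ++ s' -> b = b' /\ s = s'.
Proof.
elim: b b' => //= z b IH [//|z' b'] /= hb hb' [zz']; move: hb hb'.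
rewrite -{}zz'; case: ifP => _; first by move=> /eqP -> /eqP -> /= ->.
by move=> bb bb' /(IH _ bb bb')[-> ->].
Qed.

(** The strong Markov property at the first point above the lower level [c']: either this point is
    above [c] too, or a fresh block for [c] starts there. *)
Lemma BS_dec c' c x F : c' <= c -> (forall s, 0 <= F s)%E ->
  BS c x F = BS c' x (fun b => if c < last x b then F b
                       else BS c (last x b) (fun s => F (b ++ s))).
Proof.
move=> cc' F0; rewrite {1}/BS.
rewrite (reindex_esum ([set b | block c' b] `*``
   (fun b => [set s | block c (b ++ s)])) _ (fun p => p.1 ++ p.2)); last first.
  split=> /=.
  - by move=> [b s] [].
  - move=> [b s] [b' s'] /=; rewrite !inE/= => -[bb _] [bb' _].
    by move=> /(block_cat_inj bb bb')[-> ->].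
  - move=> s /= bs; have [b [s' [bb sE]]] := block_split cc' bs.
    by exists (b, s') => //=; rewrite -sE.
rewrite -(esum_esum (a := fun b s => ((weight x (b ++ s))%:E * F (b ++ s))%E));
  last first.
  by move=> b s _ _; rewrite mule_ge0 ?weight_ge0E.
apply: eq_esum => b /= bb.
have -> : [set s | block c (b ++ s)] =
    (if c < last x b then [set [::]] else [set s | block c s]).
  have -> : last x b = last 0 b by case: b bb.
  apply/seteqP; split=> s /=; rewrite (block_cut s cc' bb); case: ifP => // _;
    by move/eqP.
case: ifP => _.
  by rewrite esum_set1 ?cats0// mule_ge0 ?weight_ge0E.
rewrite -esum_cmul ?weight_ge0E//; last by move=> s _; rewrite mule_ge0
  ?weight_ge0E.
by apply: eq_esum => s _; rewrite weight_cat EFinM muleA.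
Qed.

Definition indic (b : bool) : \bar R := if b then 1%E else 0%E.

Lemma indic_ge0 b : (0 <= indic b)%E. Proof. by case: b. Qed.

Lemma indic_le1 b : (indic b <= 1)%E. Proof. by case: b => /=. Qed.

Lemma sum_steps_le1 x (a : int -> \bar R) : (forall j, j \in steps -> a j <=
  1)%E ->
  (\sum_(j <- steps) (w x j)%:E * a j <= 1)%E.
Proof.
move=> a1; have [w0 w1] := w_env x; rewrite -[leRHS]/(1%:E) -w1 -sumEFin.
rewrite big_seq [leRHS]big_seq; apply: lee_sum => j js.
by rewrite -[leRHS]mule1 lee_wpmul2l ?lee_fin ?w0 ?a1.
Qed.

(** Bounding the length supplies the induction on which first-step analysis can run. *)
Lemma BS_size_le1 c x n : (BS c x (fun s => indic (size s <= n)%N) <= 1)%E.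
Proof.
elim: n x => [|n IH] x.
  rewrite /BS esum1 ?lee01// => -[|z s]; first by [].
  by move=> _; rewrite mule0.
rewrite BS_step; last by move=> s; exact: indic_ge0.
apply: sum_steps_le1 => j _; case: ifP => _; first exact: indic_le1.
exact: IH.
Qed.

(** Each finite partial sum involves words of bounded length only, so the truncated bound passes to
    the supremum. *)
Lemma BS_le1 c x F : (forall s, 0 <= F s)%E -> (forall s, F s <= 1)%E ->
  (BS c x F <= 1)%E.
Proof.
move=> F0 F1; apply: (@le_trans _ _ (BS c x (fun=> 1%E))).
  by apply: le_BS => // s _ _.
apply: ge_ereal_sup => _ [X [finX XS] <-].
pose n := (\max_(s <- finmap.enum_fset (fset_set X)) size s)%N.
apply: le_trans (BS_size_le1 c x n).
apply: (@le_trans _ _ (\sum_(s \in X) ((weight x s)%:E * indic (size s <=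
  n)%N)))%E.
  apply: lee_fsum => // s Xs; rewrite /indic ifT// /n.
  by rewrite (big_rem s)/= ?leq_maxl// in_fset_set// inE.
by apply: ereal_sup_ubound; exists X.
Qed.

End Words.

(** * Compound laws *)

Lemma count_enum (I : finType) (P : pred I) : count P (enum I) = (\sum_(i | P
  i) 1)%N.
Proof. by rewrite -sum1_count big_enum_cond. Qed.

Section Compound.
Context {R : realType} (K : nat) (p : 'I_K -> 'rV[nat]_K -> R).
Hypothesis p_ge0 : forall l v, 0 <= p l v.

(** The mean of [psi] at a sum of independent vectors, one per entry of [ls]. A list is used instead
    of a vector of multiplicities because cutting a path concatenates the lists of its
    excursions. *)
Fixpoint compound (ls : seq 'I_K) (psi : 'rV[nat]_K -> \bar R) : \bar R :=
  if ls is l :: ls' then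
    (\esum_(a in [set: 'rV[nat]_K])
       ((p l a)%:E * compound ls' (fun b => psi (a + b)%R)))%E
  else psi 0.

Lemma compound_ge0 ls psi : (forall a, 0 <= psi a)%E -> (0 <= compound ls
  psi)%E.
Proof.
elim: ls psi => [|l ls IH] psi psi0 /=; first exact: psi0.
by apply: esum_ge0 => a _; rewrite mule_ge0 ?lee_fin ?p_ge0 ?IH.
Qed.

Lemma eq_compound ls psi psi' : psi =1 psi' -> compound ls psi = compound ls
  psi'.
Proof.
elim: ls psi psi' => [|l ls IH] psi psi' e /=; first exact: e.
apply: eq_esum => a _; congr (_ * _)%E; apply: IH => b; exact: e.
Qed.

Lemma compound_cat ls1 ls2 psi :
  compound (ls1 ++ ls2) psi = compound ls1 (fun a => compound ls2 (fun b => psi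
    (a + b))).
Proof.
elim: ls1 psi => [|l ls IH] psi /=; first by apply: eq_compound => b; rewrite
  add0r.
apply: eq_esum => a _; congr (_ * _)%E; rewrite IH.
by apply: eq_compound => b; apply: eq_compound => b'; rewrite addrA.
Qed.

Lemma compound_cmul ls k psi : (0 <= k)%E -> (forall a, 0 <= psi a)%E ->
  compound ls (fun a => k * psi a)%E = (k * compound ls psi)%E.
Proof.
move=> k0; elim: ls psi => [//|l ls IH] psi psi0 /=.
rewrite -esum_cmul//; last first.
  by move=> a _; rewrite mule_ge0 ?lee_fin ?p_ge0 ?compound_ge0.
by apply: eq_esum => a _; rewrite IH// muleCA.
Qed.

Lemma compound_esum ls (T : choiceType) (S : set T) (F : T -> 'rV[nat]_K ->
  \bar R) :
  (forall t a, 0 <= F t a)%E ->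
  compound ls (fun a => \esum_(t in S) F t a)%E = (\esum_(t in S) compound ls
    (F t))%E.
Proof.
elim: ls F => [//|l ls IH] F F0 /=; rewrite esum_swap; last first.
  by move=> t a _ _; rewrite mule_ge0 ?lee_fin ?p_ge0 ?compound_ge0.
by apply: eq_esum => a _; rewrite IH// esum_cmul ?lee_fin// => t _; rewrite
  compound_ge0.
Qed.

Lemma compound_fubini ls1 ls2 (F : 'rV[nat]_K -> 'rV[nat]_K -> \bar R) :
  (forall a b, 0 <= F a b)%E ->
  compound ls1 (fun a => compound ls2 (F a)) = compound ls2 (fun b => compound
    ls1 (F ^~ b)).
Proof.
elim: ls1 F => [//|l ls1 IH] F F0 /=; rewrite compound_esum; last first.
  by move=> a b; rewrite mule_ge0 ?lee_fin ?p_ge0 ?compound_ge0.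
apply: eq_esum => a _; rewrite compound_cmul ?lee_fin//; last first.
  by move=> b; rewrite compound_ge0.
by congr (_ * _)%E; rewrite IH.
Qed.

(** Exchanging neighbouring segments generates all permutations, and one such exchange is Fubini
    together with commutativity of the sum. *)
Lemma compound_perm ls ls' psi : (forall a, 0 <= psi a)%E ->
  perm_eq ls ls' -> compound ls psi = compound ls' psi.
Proof.
move=> psi0; move/(catCA_perm_ind (P := fun s => compound ls psi = compound s
  psi)).
apply => // s1 s2 s3 ->; rewrite !compound_cat.
transitivity (compound s1 (fun a => compound s2 (fun b => compound s3 (fun c =>
  psi (a + (b + c)))))).
  by apply: eq_compound => a; rewrite compound_cat.
rewrite compound_fubini; last by move=> a b; rewrite compound_ge0.
apply: eq_compound => b; rewrite compound_cat; apply: eq_compound => a; apply: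
  eq_compound => c.
by rewrite addrCA.
Qed.

(** The functions vanish outside [r], so that the index type stays fixed while the induction on [r]
    frees one coordinate at a time. *)
Lemma esum_ffun_compound (I : finType) (tg : I -> 'I_K) (r : seq I) psi : uniq
  r ->
  (forall a, 0 <= psi a)%E ->
  (\esum_(x in [set x : {ffun I -> 'rV[nat]_K} | forall k, k \notin r -> x k =
    0%R])
     ((\prod_(k <- r) p (tg k) (x k))%R%:E * psi (\sum_(k <- r) x k)%R)
   = compound (map tg r) psi)%E.
Proof.
elim: r psi => [|k r IH] psi.
  move=> _ psi0 /=; rewrite (_ : mkset _ = [set [ffun=> 0]]).
    by rewrite esum_set1 !big_nil ?mul1e.
  apply/seteqP; split=> [x /= x0|x /= -> k _]; last by rewrite ffunE.
  by apply/ffunP => k; rewrite x0// ffunE.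
rewrite /= => /andP[kr ur] psi0.
pose e (q : 'rV[nat]_K * {ffun I -> 'rV[nat]_K}) : {ffun I -> 'rV[nat]_K} :=
  [ffun j => if j == k then q.1 else q.2 j].
pose S := [set x : {ffun I -> 'rV[nat]_K} | forall j, j \notin r -> x j = 0].
rewrite (reindex_esum ([set: 'rV[nat]_K] `*`` fun=> S) _ e); last first.
  split=> /=.
  - move=> [a x] /= [_ xS] j; rewrite inE negb_or => /andP[/negbTE jk jr].
    by rewrite ffunE jk xS.
  - move=> [a x] [a' x']; rewrite !inE /= => -[_ xS] [_ xS'] /ffunP ee.
    congr (_, _); first by have := ee k; rewrite !ffunE eqxx.
    apply/ffunP => j; have [->|jk] := eqVneq j k; first by rewrite xS ?xS'.
    by have := ee j; rewrite !ffunE (negbTE jk).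
  - move=> x /= xS; exists (x k, [ffun j => if j == k then 0 else x j]) => /=.
      split=> // j jr; rewrite ffunE; case: eqVneq => // jk.
      by rewrite xS// inE negb_or jk.
    by apply/ffunP => j; rewrite !ffunE /=; case: eqVneq => [->|].
have erk a x j : j \in r -> e (a, x) j = x j.
  by move=> jr; rewrite ffunE; case: eqVneq => // jk; rewrite -jk jr in kr.
have ekk a x : e (a, x) k = a by rewrite ffunE eqxx.
transitivity (\esum_(a in [set: 'rV[nat]_K]) \esum_(x in S)
   ((p (tg k) a)%:E * ((\prod_(j <- r) p (tg j) (x j))%R%:E *
     psi (a + \sum_(j <- r) x j)%R)))%E.
  rewrite esum_esum; last first.
    move=> a x _ _; rewrite !mule_ge0 ?lee_fin//; exact: prodr_ge0.
  apply: eq_esum => -[a x] _; rewrite !big_cons ekk EFinM -muleA.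
  congr (_ * (_%:E * psi (_ + _)%R))%E; apply: eq_big_seq => j jr;
    by rewrite erk.
apply: eq_esum => a _; rewrite esum_cmul ?lee_fin//; last first.
  by move=> x _; rewrite mule_ge0 ?lee_fin//; exact: prodr_ge0.
by congr (_ * _)%E; rewrite -IH.
Qed.

Lemma offspring_sum_lawE ls v :
  offspring_sum_law p (\row_l count_mem l ls) v =
  compound ls (fun b => indic (b == v)).
Proof.
pose u : 'rV[nat]_K := \row_l count_mem l ls.
pose I : finType := {l : 'I_K & 'I_(u ord0 l)}.
(* The index type of [offspring_sum_law] contains each type as often as [ls] does; the double sum
   counts the pairs with a given first component. *)
have pm : perm_eq ls (map (@tag _ _) (enum I)).
  apply/allP => l _; rewrite /= count_map count_enum /=.
  have := @sig_big_dep _ _ addn 'I_K (fun l => 'I_(u ord0 l))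
    (fun l' => l' == l) (fun _ _ => true) (fun _ _ => 1%N).
  rewrite big_pred1_eq sum1_card card_ord mxE => ->.
  by apply/eqP; apply: eq_bigl => k; rewrite andbT.
rewrite (compound_perm _ pm); last by move=> a; exact: indic_ge0.
rewrite -esum_ffun_compound ?enum_uniq//; last by move=> a; exact: indic_ge0.
rewrite /offspring_sum_law -/u -/I esum_mkcond [RHS]esum_mkcond.
apply: eq_esum => x _; rewrite [RHS]ifT; last first.
  by apply/mem_set => k /=; rewrite mem_enum.
rewrite !big_enum /=; case: ifPn => [/set_mem /= ->|/negP nx].
  by rewrite eqxx mule1.
rewrite /indic ifF ?mule0//; apply/eqP => xv; apply: nx; exact/mem_set.
Qed.

End Compound.

(** * Excursions in words *)

(* [fstep c l] and [lstep c l] are the first and the last step of an excursion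
   of type [l] at level [c + 1]; the level is named after the barrier [c] below
   which the excursion stays. *)
Definition fstep (c : int) (l : 'I_9) : int * int :=
  nth (0, 0) [:: (c + 1, c); (c + 1, c - 1); (c + 2, c)] (l %/ 3).

Definition lstep (c : int) (l : 'I_9) : int * int :=
  nth (0, 0) [:: (c, c + 1); (c - 1, c + 1); (c, c + 2)] (l %% 3).

(** At most one entry: the list is empty for steps that belong to no type and for an excursion that
    the word does not complete. *)
Definition exc_type (c : int) (f : int * int) (e : option (int * int)) : seq
  'I_9 :=
  [seq l <- enum 'I_9 | (fstep c l == f) && (Some (lstep c l) == e)].

Fixpoint exc_types (c y : int) (q : seq int) : seq 'I_9 :=
  if q is z :: q' then
    (if z <= c < y then exc_type c (y, z) (exit_step c z q') else [::]) ++
      exc_types c z q'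
  else [::].

Definition exc_count (c y : int) (q : seq int) : 'rV[nat]_9 :=
  \row_l count_mem l (exc_types c y q).

Lemma exit_step_cat c x q1 q2 : x <= c -> c < last x q1 ->
  exit_step c x (q1 ++ q2) = exit_step c x q1.
Proof.
elim: q1 x => [|z q1 IH] x /= xc; first by rewrite ltNge xc.
by case: (ltP c z) => // zc /IH ->.
Qed.

(** The cut is at a point above [c], hence no excursion straddles it. *)
Lemma exc_types_cat c y q1 q2 : c < last y q1 ->
  exc_types c y (q1 ++ q2) = exc_types c y q1 ++ exc_types c (last y q1) q2.
Proof.
elim: q1 y => [//|z q1 IH] y /= cl; rewrite IH// catA; congr ((_ ++ _) ++ _).
by case: (leP z c) => //= zc; rewrite exit_step_cat.
Qed.

Lemma exc_count_cat c y q1 q2 : c < last y q1 ->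
  exc_count c y (q1 ++ q2) = exc_count c y q1 + exc_count c (last y q1) q2.
Proof.
by move=> cl; apply/rowP => l; rewrite !mxE exc_types_cat// count_cat.
Qed.

Lemma exc_types_block c x s : x <= c -> block c s -> exc_types c x s = [::].
Proof.
elim: s x => //= z s IH x xc; rewrite [c < x]ltNge xc andbF/=.
by case: (ltP c z) => [_ /eqP ->|zc] //; exact: IH.
Qed.

Lemma fstep_lt c l : (fstep c l).2 <= c < (fstep c l).1.
Proof.
rewrite /fstep; have : (l %/ 3 < 3)%N by rewrite ltn_divLR.
by case: (l %/ 3)%N => [|[|[|]]]//= _; lia.
Qed.

Lemma step_inj c l l' : fstep c l = fstep c l' -> lstep c l = lstep c l' -> l =
  l'.
Proof.
move=> fl ll; apply/val_inj; rewrite /= (divn_eq l 3) (divn_eq l' 3).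
have d k : (k < 9)%N -> (k %/ 3 < 3)%N by move=> k9; rewrite ltn_divLR.
have m k : (k %% 3 < 3)%N by rewrite ltn_mod.
move: fl ll; rewrite /fstep /lstep; move: (d _ (ltn_ord l)) (d _ (ltn_ord l')).
move: (m l) (m l').
case: (l %/ 3)%N (l' %/ 3)%N => [|[|[|]]]// [|[|[|]]]//;
case: (l %% 3)%N (l' %% 3)%N => [|[|[|]]]// [|[|[|]]]//= _ _ _ _;
  by move=> /eqP + /eqP; rewrite !xpair_eqE; lia.
Qed.

Lemma exc_type_step c l : exc_type c (fstep c l) (Some (lstep c l)) = [:: l].
Proof.
rewrite /exc_type -(filter_pred1_uniq (enum_uniq 'I_9) (mem_enum _ l)).
apply: eq_filter => l' /=; apply/andP/eqP => [[/eqP f /eqP[g]]|->//].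
exact: step_inj f g.
Qed.

Lemma count_exc_type c f e l :
  count_mem l (exc_type c f e) = (fstep c l == f) && (Some (lstep c l) == e).
Proof.
rewrite /exc_type count_filter -(@eq_count _ (fun l' => (l' == l) &&
  ((fstep c l == f) && (Some (lstep c l) == e)))); last first.
  by move=> l' /=; case: eqP => [->|].
case: (_ && _); last first.
  by rewrite -[RHS](count_pred0 (enum 'I_9)); apply: eq_count => l'; rewrite
    andbF.
rewrite (@eq_count _ _ (pred1 l)) => [|l']; last by rewrite andbT.
by rewrite count_uniq_mem ?enum_uniq// mem_enum.
Qed.

(** All points before the last are at most [c], hence at most [c']; steps between them neither enter
    nor leave the region below [c'], and only the last step can matter. *)
Lemma skeleton c c' x s q e : c <= c' -> x <= c -> block c s ->
  exit_step c x s = Some e ->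
  exit_step c' x (s ++ q) = exit_step c' e.1 (e.2 :: q) /\
  exc_types c' x (s ++ q) = exc_types c' e.1 (e.2 :: q).
Proof.
move=> cc'; elim: s x => //= z s IH x xc; case: (ltP c z) => [_ /eqP ->
  [<-]//|zc].
move=> bs /[dup] es /(IH z zc bs)[/= -> ->].
by rewrite !ltNge (le_trans zc cc') (le_trans xc cc') andbF.
Qed.

(* [Phi] does not see what happens inside the stretches below [c]. *)
Definition skeletal (A : Type) (c : int) (Phi : seq int -> A) := forall q1 x s
  q2 e,
  x <= c -> block c s -> exit_step c x s = Some e ->
  Phi (q1 ++ x :: s ++ q2) = Phi (q1 ++ [:: x, e.1, e.2 & q2]).

Lemma exit_ends c x s e : x <= c -> block c s -> exit_step c x s = Some e ->
  e.1 <= c < e.2.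
Proof.
move=> xc bs es; have [y [+ /(_ xc)]] := block_exit x bs.
by rewrite es => -[->] -> /=; exact: block_last.
Qed.

Lemma skeletal_exc_types c c' y : c <= c' -> skeletal c (exc_types c' y).
Proof.
move=> cc' q1 x s q2 e xc bs es.
have /andP[e1 _] := exit_ends xc bs es.
have h z : exit_step c' z (x :: s ++ q2) = exit_step c' z [:: x, e.1, e.2 & q2].
  have [E _] := skeleton q2 cc' xc bs es.
  by rewrite /= E /= !ltNge (le_trans xc cc') (le_trans e1 cc').
have h1 q z : exit_step c' z (q ++ x :: s ++ q2) =
    exit_step c' z (q ++ [:: x, e.1, e.2 & q2]).
  by elim: q z => [|u q IH] z; [exact: h|rewrite !cat_cons /= IH].
elim: q1 y => [|z q1 IH] y; last by rewrite !cat_cons /= IH h1.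
have [E T] := skeleton q2 cc' xc bs es.
rewrite /= E T /= [_ < e.1]ltNge (le_trans e1 cc') /=.
by rewrite [_ < x]ltNge (le_trans xc cc') andbF.
Qed.

Lemma skeletal_cat A c (Phi : seq int -> A) b :
  skeletal c Phi -> skeletal c (fun q => Phi (b ++ q)).
Proof. by move=> sk q1 x s q2 e xc bs es; rewrite catA (sk (b ++ q1) x s q2 e
  xc bs es) -catA. Qed.

Section Law.
Context {R : realType} (w : int -> int -> R) (w_env : environment w).
Local Notation BS := (block_sum w).

(** The weight of the first step is left out, as it would cancel in the conditional law. Types A and
    C with the same last step thus have the same mass. *)
Definition mass (c : int) (l : 'I_9) : \bar R :=
  BS c (fstep c l).2 (fun s => indic (exit_step c (fstep c l).2 s == Some
    (lstep c l))).

(** The first step is put in front of the word when children are counted, since for type B it is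
    also the first step of a type C child. *)
Definition joint (c : int) (l : 'I_9) (v : 'rV[nat]_9) : \bar R :=
  BS c (fstep c l).2 (fun s => indic
    ((exit_step c (fstep c l).2 s == Some (lstep c l)) &&
     (exc_count (c - 1) (fstep c l).1 ((fstep c l).2 :: s) == v))).

(* The conditional law of the children of an excursion of type [l] at level
   [c + 1], made a point mass at [0] for types that do not occur. *)
Definition law (c : int) (l : 'I_9) (v : 'rV[nat]_9) : R :=
  if mass c l == 0%E then (v == 0)%:R else fine (joint c l v) / fine (mass c l).

Lemma BS_ind_fin c x (Q : pred (seq int)) : BS c x (fun s => indic (Q s)) \is a
  fin_num.
Proof.
rewrite ge0_fin_numE; last by apply: BS_ge0 => // s; exact: indic_ge0.
apply: le_lt_trans (ltry 1); apply: BS_le1 => // s;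
  [exact: indic_ge0|exact: indic_le1].
Qed.

Lemma mass_ge0 c l : (0 <= mass c l)%E.
Proof. by apply: BS_ge0 => // s; exact: indic_ge0. Qed.

Lemma joint_ge0 c l v : (0 <= joint c l v)%E.
Proof. by apply: BS_ge0 => // s; exact: indic_ge0. Qed.

Lemma joint_le_mass c l v : (joint c l v <= mass c l)%E.
Proof.
apply: le_BS => // s; first exact: indic_ge0.
by move=> _ _; case: (exit_step _ _ _ == _) => //=; exact: indic_le1.
Qed.

Lemma law_ge0 c l v : 0 <= law c l v.
Proof.
rewrite /law; case: ifP => // _.
by apply: divr_ge0; apply: fine_ge0; [exact: joint_ge0|exact: mass_ge0].
Qed.

(** The division-free form of [law]: where the mass is 0, so is the joint mass, and the default law
    does no harm. *)
Lemma mass_law c l v : (mass c l * (law c l v)%:E = joint c l v)%E.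
Proof.
rewrite /law; case: ifPn => [/eqP m0|m0].
  rewrite m0 mul0e; apply/eqP; rewrite eq_le joint_ge0/=.
  by have := joint_le_mass c l v; rewrite m0 => ->.
rewrite -[X in (X * _)%E](fineK (BS_ind_fin _ _ _)) -EFinM mulrC divfK.
  by rewrite fineK// BS_ind_fin.
by rewrite fine_eq0// BS_ind_fin.
Qed.

Lemma esum_joint c l : (\esum_(v in [set: 'rV[nat]_9]) joint c l v = mass c
  l)%E.
Proof.
rewrite -(BS_esum w_env); last by move=> v s; exact: indic_ge0.
apply: eq_BS => // s _ _; case: (exit_step _ _ _ == _) => /=.
  rewrite -[RHS](@esum_pick _ _ (exc_count (c - 1) (fstep c l).1 ((fstep c l).2
    :: s))
    (fun=> 1%E))//.
by rewrite esum1.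
Qed.

Lemma esum_law c l : (\esum_(v in [set: 'rV[nat]_9]) (law c l v)%:E = 1)%E.
Proof.
have [m0|m0] := eqVneq (mass c l) 0%E.
  rewrite -[RHS](@esum_pick _ _ (0 : 'rV[nat]_9) (fun=> 1%E))//.
  by apply: eq_esum => v _; rewrite /law m0 eqxx eq_sym; case: eqP.
have := esum_joint c l; under eq_esum do rewrite -mass_law.
rewrite esum_cmul ?mass_ge0//; last by move=> v _; rewrite lee_fin law_ge0.
have /fineK := BS_ind_fin c (fstep c l).2 (fun s => exit_step c (fstep c l).2 s
  == Some (lstep c l)).
rewrite -/(mass c l) => mE h; set E := esum _ _ in h *.
move: m0 mE h; case: (mass c l) => [r|//|//] r0 _ h.
have {}r0 : r != 0 by apply: contra_neq r0 => ->.
by rewrite -[E]mul1e -[X in (X * E)%E]/(1%:E) -(mulVf r0) EFinM -muleA h -EFinM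
  mulVf.
Qed.

(** Since jumps have size at most 2, only three last steps can lead from below to above [c]; other
    words have weight 0. *)
Lemma BS_exit c x F : x <= c -> (forall s, 0 <= F s)%E ->
  BS c x F = (\sum_(k < 3) BS c x (fun s =>
    indic (exit_step c x s == Some (lstep c (inord k))) * F s))%E.
Proof.
move=> xc F0; rewrite -BS_sum//; last by move=> k s; rewrite mule_ge0
  ?indic_ge0.
apply: eq_BS => // s bs ws; rewrite -ge0_sume_distrl; last first.
  by move=> k _; exact: indic_ge0.
rewrite -[LHS]mul1e; congr (_ * _)%E.
have [y es] : exists y, exit_step c x s = Some (y, last x s) /\
    (y <= c /\ last x s - y \in steps).
  elim: s x xc bs ws => //= z s IH x xc.
  case: (ltP c z) => [_ /eqP -> /=|zc bs].
    by move=> h; exists x; split=> //; split=> //; move: h; case: ifP; rewrite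
      ?mul0r ?ltxx.
  case: ifP => _; last by rewrite mul0r ltxx.
  move=> h; apply: IH => //; rewrite lt_def (weight_ge0 w_env) andbT.
  by apply: contraTneq h => ->; rewrite mulr0 ltxx.
case: es => -> [yc]; have := block_last x bs.
move: (last x s) => z cz; rewrite !inE !big_ord_recr big_ord0 /= /lstep
  !inordK//=.
move=> st; rewrite /indic.
have : [\/ (y, z) = (c, c + 1), (y, z) = (c - 1, c + 1) | (y, z) = (c, c + 2)].
  move: st => /or4P[] /eqP st; [exfalso|exfalso| |]; try lia.
  - by apply: Or31; congr (_, _); lia.
  - have [yc1|yc1] : y = c \/ y = c - 1 by lia.
      by apply: Or33; congr (_, _); lia.
    by apply: Or32; congr (_, _); lia.
have no a b a' b' : (a : int) != a' \/ (b : int) != b' ->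
    (Some (a, b) == Some (a', b')) = false.
  by rewrite (inj_eq Some_inj) xpair_eqE; case=> /negbTE ->; rewrite ?andbF.
by case=> ->; rewrite eqxx !no ?adde0 ?add0e//; lia.
Qed.

End Law.

(** * The branching property *)

Section Branching.
Context {R : realType} (w : int -> int -> R) (w_env : environment w).
Local Notation BS := (block_sum w).
Local Notation law := (law w).
Local Notation compound c := (compound (law c)).

Lemma compound1 (c : int) l (psi : 'rV[nat]_9 -> \bar R) :
  compound c [:: l] psi = (\esum_(a in [set: 'rV[nat]_9]) ((law c l a)%:E * psi
    a))%E.
Proof. by apply: eq_esum => a _ /=; rewrite addr0. Qed.

(** Both sides are the mass of the type times the mean of [H] under its conditional law. *)
Lemma BS_joint c l (H : 'rV[nat]_9 -> \bar R) : (forall v, 0 <= H v)%E ->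
  BS c (fstep c l).2 (fun s =>
    indic (exit_step c (fstep c l).2 s == Some (lstep c l)) *
    H (exc_count (c - 1)%R (fstep c l).1 ((fstep c l).2 :: s)))%E
  = BS c (fstep c l).2 (fun s =>
    indic (exit_step c (fstep c l).2 s == Some (lstep c l)) * compound c [:: l]
      H)%E.
Proof.
move=> H0.
transitivity (mass w c l * compound c [:: l] H)%E; last first.
  rewrite muleC -BSZ//; [|by apply: compound_ge0 => //; exact: law_ge0|by
    move=> s; exact: indic_ge0].
  by apply: eq_BS => // s _ _; rewrite muleC.
rewrite compound1 -esum_cmul ?mass_ge0//; last first.
  by move=> a _; rewrite mule_ge0// lee_fin law_ge0.
under [RHS]eq_esum do rewrite muleA mass_law// muleC.
under [RHS]eq_esum.
  move=> v _; rewrite -BSZ//; last by move=> s; exact: indic_ge0.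
  over.
rewrite -BS_esum//; last by move=> v s; rewrite mule_ge0 ?indic_ge0.
apply: eq_BS => // s _ _; case: (exit_step _ _ _ == _) => /=; last first.
  by rewrite mul0e esum1// => v _; rewrite mule0.
rewrite mul1e -[LHS](@esum_pick _ _ _ H)//; apply: eq_esum => v _.
by case: eqP; rewrite ?mule1 ?mule0.
Qed.

Lemma fstep_lstep_inord c m k : (m < 3)%N -> (k < 3)%N ->
  let l : 'I_9 := inord (m * 3 + k) in
  fstep c l = nth (0, 0) [:: (c + 1, c); (c + 1, c - 1); (c + 2, c)] m /\
  lstep c l = lstep c (inord k).
Proof.
move=> m3 k3 /=; rewrite /fstep /lstep !inordK; [|lia|lia].
by rewrite modnMDl divnMDl// divn_small ?addn0.
Qed.

(** The branching identity for one block: [G] sees only the first point and the last step, which fix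
    the type, so the children can be averaged out type by type. *)
Lemma block_sum_compound c y (G : int -> option (int * int) -> 'rV[nat]_9 ->
  \bar R) :
  c < y -> (forall x e a, 0 <= G x e a)%E ->
  BS c y (fun b => G (head 0 b) (exit_step c (head 0 b) (behead b)) (exc_count
    (c - 1) y b))
  = BS c y (fun b => compound c (exc_types c y b)
      (G (head 0 b) (exit_step c (head 0 b) (behead b)))).
Proof.
move=> cy G0; have L0 := compound_ge0 (@law_ge0 _ w w_env c).
rewrite !BS_step//; last by move=> s; exact: L0.
rewrite !big_seq; apply: eq_bigr => j js; congr (_ * _)%E; case: ifPn => /=
  [cx|].
  rewrite [_ <= c]leNgt cx /=; congr G; apply/rowP => l; rewrite !mxE/=.
  by rewrite ifF//; lia.
rewrite -leNgt; set x := y + j => xc; have xE : x = y + j by [].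
clearbody x.
(* A step from above [c] to [x <= c] is one of the three first steps A, B, C; [m] is its number. *)
have [m m3 f] : exists2 m, (m < 3)%N &
    (y, x) = nth (0, 0) [:: (c + 1, c); (c + 1, c - 1); (c + 2, c)] m.
  move: js xE; rewrite !inE => /or4P[] /eqP -> xE; [| |exfalso; lia|exfalso;
    lia].
    have [yc|yc] : y = c + 1 \/ y = c + 2 by lia.
      by exists 1%N => //=; congr (_, _); lia.
    by exists 2%N => //=; congr (_, _); lia.
  by exists 0%N => //=; congr (_, _); lia.
rewrite !(@BS_exit _ w w_env c x)//; last by move=> s; exact: L0.
apply: eq_bigr => k _.
have [lf lk] := fstep_lstep_inord c m3 (ltn_ord k).
set l := inord _ in lf lk; rewrite -lk; rewrite -f in lf.
have := @BS_joint c l (G x (Some (lstep c l))) (G0 _ _).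
rewrite lf /= => E.
transitivity (BS c x (fun s => indic (exit_step c x s == Some (lstep c l)) *
    G x (Some (lstep c l)) (exc_count (c - 1)%R y (x :: s)))%E).
  by apply: eq_BS => // s _ _; case: eqP => [->|] //=; rewrite !mul0e.
rewrite E; apply: eq_BS => // s bs _; case: eqP => [->|]; last by rewrite
  !mul0e.
by rewrite xc cy (exc_types_block xc bs) cats0 -lf exc_type_step.
Qed.

(** Turns the data kept of a block back into a word, so that a skeletal [Phi] can be applied to
    it. *)
Definition squeeze (x : int) (e : option (int * int)) : seq int :=
  if e is Some (u, v) then [:: x; u; v] else [:: x].

Lemma squeeze_block c b y : block c b ->
  last y (squeeze (head 0 b) (exit_step c (head 0 b) (behead b))) = last y b.
Proof.
case: b => //= x s; case: (ltP c x) => [_ /eqP -> //|xc bs].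
have [u [es _]] := block_exit x bs; by rewrite es.
Qed.

Lemma squeeze_skeletal c b (A : Type) (Phi : seq int -> A) s : skeletal c Phi ->
  block c b -> Phi (b ++ s) =
    Phi (squeeze (head 0 b) (exit_step c (head 0 b) (behead b)) ++ s).
Proof.
case: b => //= x q sk; case: (ltP c x) => [_ /eqP -> //|xc bq].
have [u [es _]] := block_exit x bq; rewrite es /=.
exact: (sk [::] _ _ _ _ xc bq es).
Qed.

(** Every block has exactly one letter above [c], so removing the first block lowers the bound [n].
    The bound is put on [Phi], not on the words, so that the induction hypothesis applies to the map
    [s] to [Phi (b ++ s)]. *)
Lemma BS_branching_bounded n c c0 y (Phi : seq int -> \bar R)
    (psi : 'rV[nat]_9 -> \bar R) :
  c <= c0 -> c < y -> skeletal c Phi -> (forall q, 0 <= Phi q)%E ->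
  (forall a, 0 <= psi a)%E ->
  (forall q, (n < count (fun z => (c < z)%R) q)%N -> Phi q = 0%E) ->
  BS c0 y (fun q => Phi q * psi (exc_count (c - 1)%R y q))%E =
  BS c0 y (fun q => Phi q * compound c (exc_types c y q) psi)%E.
Proof.
move=> cc0; elim: n y Phi psi => [|n IH] y Phi psi cy sk Phi0 psi0 Phin.
  apply: eq_BS => // q bq _; rewrite Phin ?mul0e// -has_count.
  apply/hasP; exists (last y q); last by apply: le_lt_trans cc0 _; exact:
    block_last.
  by case: q bq => //= z q _; exact: mem_last.
have L0 := compound_ge0 (@law_ge0 _ w w_env c).
(* The contribution of what follows a first block [p] with children [a], the later blocks being
   already averaged. *)
pose H (p : seq int) a := if c0 < last y p then (Phi p * psi a)%E else
  BS c0 (last y p) (fun s => Phi (p ++ s) *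
     compound c (exc_types c (last y p) s) (fun b => psi (a + b)%R))%E.
have H0 p a : (0 <= H p a)%E.
  rewrite /H; case: ifP => _; first by rewrite mule_ge0.
  by apply: BS_ge0 => // s; rewrite mule_ge0 ?L0.
have HE b a : block c b ->
    H (squeeze (head 0 b) (exit_step c (head 0 b) (behead b))) a = H b a.
  move=> bb; rewrite /H squeeze_block//; case: ifP => _.
    by have := squeeze_skeletal [::] sk bb; rewrite !cats0 => ->.
  by apply: eq_BS => // s _ _; rewrite -squeeze_skeletal.
transitivity (BS c y (fun b => H b (exc_count (c - 1) y b))).
  rewrite (BS_dec w_env _ cc0); last by move=> s; rewrite mule_ge0.
  apply: eq_BS => // b bb _; rewrite /H; case: ifPn => // lb.
  have cl := block_last y bb.
  rewrite -IH//; last first.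
  - move=> q nq; apply: Phin; rewrite count_cat.
    have : (0 < count (fun z => (c < z)%R) b)%N.
      rewrite -has_count; apply/hasP; exists (last y b) => //.
      by case: b bb {lb cl} => //= z b _; exact: mem_last.
    lia.
  - exact: skeletal_cat.
  by apply: eq_BS => // s _ _; rewrite exc_count_cat//; apply: lt_trans cl; lia.
transitivity (BS c y (fun b => compound c (exc_types c y b) (H b))).
  have := @block_sum_compound c y (fun x e a => H (squeeze x e) a) cy (fun x e
    => H0 _).
  rewrite (@eq_BS _ w w_env _ _ _ (fun b => H b (exc_count (c - 1) y b))); last
    first.
    by move=> b bb _; rewrite HE.
  move=> ->; apply: eq_BS => // b bb _; apply: eq_compound => a; exact: HE.
rewrite [RHS](BS_dec w_env _ cc0); last by move=> s; rewrite mule_ge0 ?L0.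
apply: eq_BS => // b bb _; rewrite /H; case: ifP => _.
  by rewrite compound_cmul//; exact: law_ge0.
rewrite /block_sum compound_esum; last first.
- by move=> s a; rewrite !mule_ge0 ?weight_ge0E ?L0.
- exact: law_ge0.
apply: eq_esum => s _; rewrite !compound_cmul ?weight_ge0E//; try exact:
  law_ge0; try by move=> *; rewrite ?mule_ge0 ?L0.
by rewrite exc_types_cat ?compound_cat//; exact: block_last.
Qed.

(* The excursions below level [c] of a path, seen from level [c], are
   independent copies attached to the parents listed by [exc_types c]. *)
Lemma BS_branching c c0 y (Phi : seq int -> \bar R) (psi : 'rV[nat]_9 -> \bar
  R) :
  c <= c0 -> c < y -> skeletal c Phi -> (forall q, 0 <= Phi q)%E ->
  (forall a, 0 <= psi a)%E ->
  BS c0 y (fun q => Phi q * psi (exc_count (c - 1)%R y q))%E =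
  BS c0 y (fun q => Phi q * compound c (exc_types c y q) psi)%E.
Proof.
move=> cc0 cy sk Phi0 psi0; pose nb (q : seq int) := count (fun z => c < z) q.
have L0 := compound_ge0 (@law_ge0 _ w w_env c).
(* Each word has finitely many letters above [c]; sorting words by this number reduces the claim to
   the bounded case. *)
have split_nb (F : seq int -> \bar R) : (forall q, 0 <= F q)%E ->
    BS c0 y F = (\esum_(n in [set: nat]) BS c0 y (fun q => indic (nb q == n) *
      F q))%E.
  move=> F0; rewrite -BS_esum//; last by move=> n q; rewrite mule_ge0
    ?indic_ge0.
  apply: eq_BS => // q _ _; rewrite -[LHS](@esum_pick _ _ (nb q) (fun=> F q))//.
  by apply: eq_esum => n _; case: eqP; rewrite ?mul1e ?mul0e.
rewrite split_nb; last by move=> q; rewrite mule_ge0.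
rewrite [RHS]split_nb; last by move=> q; rewrite mule_ge0 ?L0.
apply: eq_esum => n _; have E := @BS_branching_bounded n c c0 y
  (fun q => indic (nb q == n) * Phi q)%E psi cc0 cy.
rewrite (@eq_BS _ w w_env _ _ _ (fun q => indic (nb q == n) * Phi q *
  psi (exc_count (c - 1)%R y q))%E); last by move=> q _ _; rewrite muleA.
rewrite E//.
- by apply: eq_BS => // q _ _; rewrite muleA.
- move=> q1 x s q2 e xc bs es; rewrite (sk _ _ _ _ _ xc bs es).
  have /andP[e1 e2] := exit_ends xc bs es.
  have -> : nb (q1 ++ x :: s ++ q2) = nb (q1 ++ [:: x, e.1, e.2 & q2]) => //.
  (* The number of letters above [c] is itself skeletal, as a stretch below [c] contributes only its
     end. *)
  suff s1 : count (fun z => c < z) s = 1%N.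
    by rewrite /nb !count_cat /= count_cat s1 e2 !ltNge xc e1.
  elim: s {x xc es} bs => //= z s IH; case: (ltP c z) => [_ /eqP ->//|zc bs].
  by rewrite IH.
- by move=> q; rewrite mule_ge0 ?indic_ge0.
- by move=> q nq; rewrite /indic gtn_eqF ?mul0e.
Qed.

End Branching.

(** * Words and the quenched law *)

Lemma measurable_bigcup_count d (T : measurableType d) (I : countType)
    (D : set I) (A : I -> set T) :
  (forall i, D i -> measurable (A i)) -> measurable (\bigcup_(i in D) A i).
Proof.
move=> mA; rewrite bigcup_mkcond; apply: countable_bigcupT_measurable => // i.
by case: ifPn => // /set_mem; exact: mA.
Qed.

Lemma measure_bigcup_count d (T : measurableType d) (R : realType)
    (mu : {measure set T -> \bar R}) (I : countType) (D : set I) (A : I -> set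
      T) :
  (forall i, measurable (A i)) -> trivIset D A ->
  measurable (\bigcup_(i in D) A i) /\
  mu (\bigcup_(i in D) A i) = (\esum_(i in D) mu (A i))%E.
Proof.
move=> mA tA.
(* Countable additivity is available for sequences: numbers that encode no element of [D] get the
   empty set. *)
pose F n := if pickle_inv n is Some i then (if i \in D then A i else set0) else
  set0.
have FE : \bigcup_(i in D) A i = \bigcup_n F n.
  apply/seteqP; split=> [t [i Di At]|t [n _]].
    by exists (pickle i) => //; rewrite /F pickleK_inv mem_set.
  rewrite /F; case: pickle_inv => // i; case: ifPn => // /set_mem Di At.
  by exists i.
have mF n : measurable (F n).
  by rewrite /F; case: pickle_inv => // i; case: ifP.
have tF : trivIset setT F.
  move=> n m _ _ [t []]; rewrite /F.
  case En : (pickle_inv n) => [i|//]; case Em : (pickle_inv m) => [j|//].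
  case: ifPn => // /set_mem Di Ai; case: ifPn => // /set_mem Dj Aj.
  have ij : i = j by apply: tA => //; exists t.
  have := @pickle_invK I n; have := @pickle_invK I m; rewrite /ocancel En Em /=.
  by rewrite ij => <- <-.
rewrite FE; split; first exact: bigcup_measurable.
rewrite measure_semi_bigcup//; last exact: bigcup_measurable.
rewrite nneseries_esumT//.
transitivity (\esum_(n in pickle @` D) mu (F n))%E.
  rewrite [RHS]esum_mkcond; apply: eq_esum => n _; case: ifPn => // nD.
  rewrite /F; case En : (pickle_inv n) => [i|]; last by rewrite measure0.
  case: ifPn => [/set_mem Di|]; last by rewrite measure0.
  exfalso; move/negP: nD; apply; apply/mem_set; exists i => //.
  by have := @pickle_invK I n; rewrite /ocancel En.
rewrite esum_image; last by move=> i j _ _; exact: (pcan_inj pickleK_inv).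
by apply: eq_esum => i Di; rewrite /F pickleK_inv mem_set.
Qed.

Lemma adde_cancel0 (R : realType) (a b : \bar R) :
  a \is a fin_num -> a = (a + b)%E -> (0 <= b)%E -> b = 0%E.
Proof.
case: a b => [a| |] [b| |] // _ [] E _; congr EFin.
by apply: (addrI a); rewrite addr0.
Qed.

Section Walk.
Context {R : realType} {d : measure_display} {T : measurableType d}.
Context (w : int -> int -> R) (P : int -> probability T R) (X : nat -> T ->
  int).
Hypotheses (w_env : environment w) (X_walk : random_walk w P X).

Definition cylinder (x : int) (s : seq int) : set T :=
  history X (size s) (nth 0 (x :: s)).

Lemma measurable_X n (S : set int) : measurable (X n @^-1` S).
Proof.
have [mX _ _] := X_walk.
have -> : X n @^-1` S = \bigcup_(y in S) X n @^-1` [set y].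
  by apply/seteqP; split=> [t St|t [y Sy /= ->]//]; exists (X n t).
exact: measurable_bigcup_count.
Qed.

Lemma measurable_history n h : measurable (history X n h).
Proof.
have -> : history X n h = \bigcap_(k in [set k | (k <= n)%N]) X k @^-1` [set h
  k].
  by apply/seteqP; split=> [t Ht k /= kn|t Ht k kn]; exact: Ht.
by apply: bigcap_measurable => [|k _]; [exists 0%N|exact: measurable_X].
Qed.

Lemma measurable_cyl x s : measurable (cylinder x s).
Proof. exact: measurable_history. Qed.

Lemma cylinder_rcons x s z :
  cylinder x (rcons s z) = X (size s).+1 @^-1` [set z] `&` cylinder x s.
Proof.
rewrite /cylinder size_rcons; apply/seteqP; split=> [t Ht|t [/= Hz Ht] k].
  split; first by have := Ht (size s).+1 (leqnn _); rewrite /= nth_rcons ltnn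
    eqxx.
  move=> k ks; rewrite (Ht k (leqW ks)) -rcons_cons nth_rcons /= ltnS ks.
  by [].
rewrite leq_eqVlt => /orP[/eqP ->|ks]; first by rewrite Hz /= nth_rcons ltnn
  eqxx.
by rewrite (Ht k ks) -rcons_cons nth_rcons /= ks.
Qed.

Lemma P_cyl_step x s j : j \in steps -> (0 < P x (cylinder x s))%E ->
  P x (cylinder x (rcons s (last x s + j))) = (P x (cylinder x s) * (w (last x
    s) j)%:E)%E.
Proof.
move=> js Ps; have [_ _ /(_ x (size s) (nth 0 (x :: s)) j js)] := X_walk.
rewrite -/(cylinder x s) => /(_ Ps); rewrite -[x :: s]/(x :: s) -last_nth
  /cprob.
move=> <-; rewrite -cylinder_rcons.
have fin : P x (cylinder x s) \is a fin_num by apply: fin_num_measure; exact: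
  measurable_cyl.
rewrite -{1}(fineK fin) -EFinM mulrC divfK; last by rewrite fine_eq0// gt_eqF.
by rewrite fineK//; apply: fin_num_measure; exact: measurable_cyl.
Qed.

Lemma cylinder_next x s : cylinder x s = \bigcup_(z in [set: int]) cylinder x
  (rcons s z).
Proof.
apply/seteqP; split=> [t Ht|t [z _]]; last by rewrite cylinder_rcons => -[].
by exists (X (size s).+1 t) => //; rewrite cylinder_rcons.
Qed.

(** The walk hypothesis speaks of admissible jumps after cylinders of positive probability; null
    cylinders and other jumps are treated separately. *)
Lemma P_cyl x s : P x (cylinder x s) = (weight w x s)%:E.
Proof.
elim/last_ind: s => [|s z IH].
  have [_ /(_ x) + _] := X_walk; rewrite /= => <-; congr (P x _).
  apply/seteqP; split=> [t /(_ 0%N isT)//|t /= Ht k].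
  by rewrite leqn0 => /eqP ->.
rewrite -cats1 weight_cat /= mulr1; have Pge0 z' := measure_ge0 (P x) (cylinder
  x (rcons s z')).
have [Ps0|Ps] := eqVneq (P x (cylinder x s)) 0%E.
  have ws : weight w x s = 0 by apply/eqP; rewrite -eqe -IH Ps0.
  rewrite ws mul0r cats1; apply/eqP; rewrite eq_le Pge0 andbT.
  apply: (@le_trans _ _ (P x (cylinder x s))); last by rewrite Ps0.
  apply: le_measure; rewrite ?inE; [exact: measurable_cyl|exact:
    measurable_cyl|].
  by rewrite cylinder_rcons; exact: subIsetr.
have {}Ps : (0 < P x (cylinder x s))%E by rewrite lt_def Ps measure_ge0.
rewrite cats1; case: ifPn => zs.
  by have := P_cyl_step zs Ps; rewrite subrKC IH -EFinM => ->.
(* The four admissible continuations already carry the whole probability of the cylinder, which is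
   finite, so nothing is left for another jump. *)
rewrite mulr0; pose S := [set` [seq last x s + j | j <- steps]].
have tr : trivIset [set: int] (fun z => cylinder x (rcons s z)).
  move=> z1 z2 _ _ [t []]; rewrite !cylinder_rcons => -[/= <- _] [/= <- _] //.
have [_] := measure_bigcup_count (P x) (fun z => measurable_cyl x (rcons s z))
  tr.
rewrite -cylinder_next (esumID S)// setTI.
rewrite [X in (X + _)%E](_ : _ = P x (cylinder x s)).
  have fin : P x (cylinder x s) \is a fin_num by apply: fin_num_measure; exact:
    measurable_cyl.
  move=> /(adde_cancel0 fin) e0; apply/eqP; rewrite eq_le Pge0 andbT.
  have /eqP := e0 (esum_ge0 (fun i _ => measure_ge0 _ _)); rewrite eq_le =>
    /andP[+ _].
  apply: le_trans.
  apply: (esum_ge_term (a := fun z => P x (cylinder x (rcons s z)))) => //=.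
  by split=> // /mapP[j js zE]; move: zs; rewrite zE addrAC subrr add0r js.
rewrite esum_fset//; last exact: finite_seq.
rewrite -fsbig_seq; last by rewrite map_inj_uniq //; exact: addrI.
rewrite big_map.
transitivity (\sum_(j <- steps) (weight w x s * w (last x s) j)%:E)%E.
  by apply: eq_big_seq => j js; have := P_cyl_step js Ps; rewrite IH -EFinM =>
    <-.
by rewrite sumEFin -mulr_sumr (w_env _).2 mulr1 IH.
Qed.

(** Blocks form a prefix-free set of words; their cylinders are therefore disjoint and the
    probabilities add up. *)
Lemma block_eq (y : nat -> int) c s s' :
  (forall k, (k < size s)%N -> y k = nth 0 s k) ->
  (forall k, (k < size s')%N -> y k = nth 0 s' k) ->
  block c s -> block c s' -> s = s'.
Proof.
wlog ss' : s s' / (size s <= size s')%N => [hw ys ys' bs bs'|ys ys' bs bs'].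
  have /orP[h|h] := leq_total (size s) (size s'); first exact: hw.
  by symmetry; apply: hw.
have E : s' = s ++ drop (size s) s'.
  rewrite -{1}(cat_take_drop (size s) s'); congr (_ ++ _).
  apply: (@eq_from_nth _ 0); first by rewrite size_takel.
  move=> k; rewrite size_takel// => ks; rewrite nth_take// -ys// -ys'//.
  exact: leq_trans ss'.
by have [] := block_cat_inj bs' bs (etrans (cats0 s') E).
Qed.

Lemma P_block c x (Q : pred (seq int)) :
  let E := [set t | exists s, [/\ block c s, Q s & cylinder x s t]] in
  measurable E /\ P x E = block_sum w c x (fun s => indic (Q s)).
Proof.
set E := [set _ | _].
have EE : E = \bigcup_(s in [set s | block c s && Q s]) cylinder x s.
  apply/seteqP; split=> [t [s [bs Qs cs]]|t [s /= /andP[bs Qs] cs]].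
    by exists s => //=; rewrite bs Qs.
  by exists s.
have tr : trivIset [set s | block c s && Q s] (cylinder x).
  move=> s s' /= /andP[bs _] /andP[bs' _] [t [cs cs']].
  apply: (@block_eq (fun k => X k.+1 t) c) => // k ks.
    exact: (cs k.+1 ks).
  exact: (cs' k.+1 ks).
have [mE PE] := measure_bigcup_count (P x) (measurable_cyl x) tr.
rewrite EE; split=> //; rewrite PE /block_sum esum_mkcond [RHS]esum_mkcond.
apply: eq_esum => s _.
have mem_b (p : pred (seq int)) : (s \in [set s | p s]) = p s.
  by apply/idP/idP => [/set_mem|h]; [|apply/mem_set].
rewrite (mem_b (fun s => block c s && Q s)) (mem_b (block c)).
by case: (block c s) => //; case: (Q s); rewrite ?mule1 ?mule0 //= P_cyl.
Qed.

End Walk.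

(** * Excursion counts of a path and of a word *)

Lemma all_iotaS (p : pred nat) k n :
  all p (iota k.+1 n) = all (fun m => p m.+1) (iota k n).
Proof. by rewrite -[k.+1]add1n iotaDl all_map. Qed.

Lemma mkseqS (A : Type) (x : nat -> A) N :
  mkseq x N.+1 = x 0%N :: mkseq (fun k => x k.+1) N.
Proof. by rewrite /mkseq /= -[1%N]addn0 iotaDl -map_comp. Qed.

Definition exits_at (x : nat -> int) (c : int) (e : int * int) (l : nat) : bool
  :=
  [&& all (fun m => x m <= c) (iota 0 l.+1), c < x l.+1 & (x l, x l.+1) == e].

Lemma count_exits (x : nat -> int) (N : nat) (c : int) (e : int * int) :
  (\sum_(l < N) exits_at x c e l)%N =
  ((x 0%N <= c) && (Some e == exit_step c (x 0%N) (mkseq (fun k => x k.+1) N)))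
    :> nat.
Proof.
elim: N x => [|N IH] x; first by rewrite big_ord0 andbF.
have exS (l : nat) : exits_at x c e l.+1 =
    (x 0%N <= c) && exits_at (fun k => x k.+1) c e l.
  by rewrite /exits_at /= (all_iotaS _ 1) -!andbA.
rewrite big_ord_recl mkseqS; under eq_bigr do rewrite exS.
case: (boolP (x 0%N <= c)) => x0 /=; last first.
  by rewrite big1// addn0 /exits_at /= (negbTE x0).
rewrite (IH (fun k => x k.+1)) {1}/exits_at /= x0 andbT /=.
by case: (ltP c (x 1%N)) => x1 /=; rewrite ?addn0 ?add0n// eq_sym.
Qed.

Lemma is_excursionS x i f e k l :
  is_excursion x i f e k.+1 l = is_excursion (fun m => x m.+1) i f e k l.
Proof. by rewrite /is_excursion all_iotaS. Qed.

Lemma is_excursion0 x c l m :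
  is_excursion x (c + 1) (fstep c l) (lstep c l) 0 m.+1 =
  (fstep c l == (x 0%N, x 1%N)) && exits_at (fun k => x k.+1) c (lstep c l) m.
Proof.
rewrite /is_excursion /= -andbA addrK all_iotaS add0n.
rewrite [c + 1 <= _]lezD1 [_ == fstep _ _]eq_sym /exits_at /= all_iotaS.
by case: (fstep c l == _); rewrite ?andbF ?andbT// -!andbA.
Qed.

Lemma nb_excursionsE x N c l :
  nb_excursions x N (c + 1) (fstep c l) (lstep c l) =
  count_mem l (exc_types c (x 0%N) (mkseq (fun k => x k.+1) N)).
Proof.
have -> : nb_excursions x N (c + 1) (fstep c l) (lstep c l) =
    (\sum_(k < N) \sum_(m < N) (is_excursion x (c + 1) (fstep c l) (lstep c l)
      k m
      && ((k + m).+1 <= N)%N : nat))%N.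
  rewrite /nb_excursions -sum1_card pair_big /= big_mkcond /=.
  by apply: eq_bigr => -[k m] _; rewrite inE.
elim: N x => [|N IH] x; first by rewrite big_ord0.
rewrite big_ord_recl mkseqS /= count_cat -(IH (fun k => x k.+1)); congr (_ +
  _)%N; last first.
  (* A start after time 0 leaves no room for the largest length, so the last summand vanishes and
     the ranges agree with those of the shifted path. *)
  apply: eq_bigr => k _; rewrite big_ord_recr /= [X in (_ + X)%N](_ : _ = 0%N).
    by rewrite addn0; apply: eq_bigr => m _; rewrite /bump /= add1n
      is_excursionS.
  by rewrite [(_ < N.+1)%N]ltnNge (_ : (N.+1 <= _ + N)%N) ?andbF// /bump; lia.
(* Length 0 is no excursion; length [m.+1] from time 0 is an exit of the shifted path after [m]
   further steps. *)
rewrite big_ord_recl /=.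
under eq_bigr => m _.
  rewrite is_excursion0 /bump /= add1n ltnS add0n ltn_ord andbT; over.
rewrite add0n.
rewrite (eq_bigr (fun m : 'I_N => (fstep c l == (x 0%N, x 1%N)) *
   exits_at (fun k => x k.+1) c (lstep c l) m)%N); last first.
  by move=> m _; case: (fstep c l == _); rewrite ?mul1n.
rewrite -big_distrr /= count_exits; case: ifPn => x01.
  by rewrite count_exc_type; move/andP: x01 => [-> _]; case: (fstep c l == _);
    rewrite ?mul1n.
rewrite -[RHS]/0%N; case: eqP => // /(congr1 (fun p => (p.2 <= c < p.1)%R)) /=.
by rewrite (negbTE x01) fstep_lt.
Qed.

Lemma excursion_vectorE x N c :
  excursion_vector x N (c + 1) = exc_count c (x 0%N) (mkseq (fun k => x k.+1)
    N).
Proof.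
apply/rowP => l; rewrite mxE [RHS]mxE -nb_excursionsE /fstep /lstep.
rewrite addrK [c + 1 - 2](_ : _ = c - 1); last lia.
rewrite [c + 1 + 1](_ : _ = c + 2); last lia.
by case: l; do 9?[case=> //].
Qed.

Lemma block_nth c s k : block c s -> (k < size s)%N ->
  (c < nth 0 s k) = (k.+1 == size s).
Proof.
elim: s k => //= z s IH k; case: (ltP c z) => [cz /eqP -> /=|zc bs].
  by rewrite ltnS leqn0 => /eqP ->.
case: k => [|k] /= ks; last exact: IH.
by rewrite ltNge zc; case: s bs {IH ks}.
Qed.

(** Restricted to successors, because the value 0 is also the dummy for a path that never becomes
    positive. *)
Lemma hit_posP x n : hit_pos x = n.+1 <->
  (0 < x n.+1 /\ forall m, (m <= n)%N -> x m <= 0).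
Proof.
rewrite /hit_pos; case: pselect => [ex|nex]; last first.
  by split=> // -[xn _]; case: nex; exists n.+1.
case: ex_minnP => m xm m_min; split=> [mn|[xn xle]].
  split=> [|k kn]; first by rewrite -mn.
  by rewrite leNgt; apply/negP => /m_min; rewrite mn ltnNge kn.
apply/eqP; rewrite eqn_leq m_min//= ltnNge; apply/negP => /xle.
by rewrite leNgt xm.
Qed.

Lemma U_of_path_local x x' i : hit_pos x = hit_pos x' ->
  (forall k, (k <= hit_pos x)%N -> x k = x' k) -> U_of_path x i = U_of_path x'
    i.
Proof.
move=> hh xx; rewrite /U_of_path -hh -(subrK 1 i) !excursion_vectorE /=.
case: ifP => _.
  rewrite -[1]add0r !excursion_vectorE /=; congr exc_count; rewrite !mkseqS /=
    xx//.
  by congr cons; apply/eq_in_map => k; rewrite mem_iota => /andP[_]; exact: xx.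
rewrite xx//; congr exc_count; apply/eq_in_map => k; rewrite mem_iota =>
  /andP[_].
exact: xx.
Qed.

Lemma U_of_path_word (x : nat -> int) (s : seq int) c : c <= 0 -> x 0%N = 0 ->
  (forall k, (k < size s)%N -> x k.+1 = nth 0 s k) -> block 0 s ->
  U_of_path x (c + 1) = exc_count c 1 (0 :: s).
Proof.
move=> c0 x0 xs bs.
have mk : mkseq (fun k => x k.+1) (size s) = s.
  by rewrite -[RHS](mkseq_nth 0); apply/eq_in_map => k; rewrite mem_iota => /xs.
have hp : hit_pos x = size s.
  case: s bs xs {mk} => // z s bs xs; apply/hit_posP; split=> [|m].
    by rewrite xs// (block_nth bs).
  case: m => [|m] ms; first by rewrite x0.
  by rewrite xs ?(leqW ms)// leNgt (block_nth bs) ?(leqW ms)// eqSS ltn_eqF.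
rewrite /U_of_path hp; case: eqP => c1.
  have {c1}-> : c = 0 by lia.
  rewrite -[X in excursion_vector _ _ X]add0r excursion_vectorE /= mkseqS /= x0.
  by rewrite mk.
(* For [c < 0] the step from 1 to 0 does not cross [c], so the path with the imaginary step gives
   the counts of all generations. *)
rewrite excursion_vectorE x0 mk; apply/rowP => l; rewrite !mxE /=.
by rewrite [0 <= c]leNgt (_ : c < 0)//; lia.
Qed.

Section WalkU.
Context {R : realType} {d : measure_display} {T : measurableType d}.
Context (w : int -> int -> R) (P : int -> probability T R) (X : nat -> T ->
  int).
Hypotheses (w_env : environment w) (X_walk : random_walk w P X).
Local Notation U := (excursion_counts X).

Lemma measurable_hit_pos n : measurable [set t | hit_pos (fun k => X k t) = n].
Proof.
have mS k : measurable [set t | hit_pos (fun k => X k t) = k.+1].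
  have -> : [set t | hit_pos (fun k => X k t) = k.+1] =
      X k.+1 @^-1` [set z | 0 < z] `&`
      \bigcap_(m in [set m | (m <= k)%N]) X m @^-1` [set z | z <= 0].
    apply/seteqP; split=> [t /= /hit_posP[]//|t /= [p n0]].
    by apply/hit_posP; split=> // m mk; exact: n0.
  apply: measurableI; first exact: measurable_X X_walk _ _.
  by apply: bigcap_measurable => [|m _]; [exists 0%N|exact: measurable_X X_walk
    _ _].
case: n => [|n]; last exact: mS.
have -> : [set t | hit_pos (fun k => X k t) = 0%N] =
    ~` \bigcup_k [set t | hit_pos (fun k => X k t) = k.+1].
  apply/seteqP; split=> [t /= h [k _ /=]|t /= h]; first by rewrite h.
  by case E : (hit_pos _) => [//|k]; case: h; exists k.
by apply: measurableC; exact: bigcup_measurable.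
Qed.

Lemma measurable_U i v : measurable [set t | U i t = v].
Proof.
(* Countably many pieces: the value of [hit_pos] and the path up to that time determine [U]. *)
pose A (p : nat * seq int) :=
  [set t | hit_pos (fun k => X k t) = p.1] `&` history X p.1 (nth 0 p.2).
pose D := [set p | exists2 t, A p t & U i t = v].
have -> : [set t | U i t = v] = \bigcup_(p in D) A p.
  apply/seteqP; split=> [t /= Ut|t [p [t' [/= h' H'] <-] [/= h H]]].
    pose n := hit_pos (fun k => X k t).
    exists (n, mkseq (fun k => X k t) n.+1) => /=; last first.
      by split=> //= k kn; rewrite nth_mkseq.
    by exists t => //; split=> //= k kn; rewrite nth_mkseq.
  apply: U_of_path_local; first by rewrite h h'.
  by move=> k; rewrite h => kp; rewrite H// H'.
apply: measurable_bigcup_count => p _; apply: measurableI.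
  exact: measurable_hit_pos.
exact: measurable_history X_walk _ _.
Qed.

End WalkU.

Lemma block_mkseq c (y : nat -> int) n :
  (forall k, (k < n)%N -> y k <= c) -> c < y n -> block c (mkseq y n.+1).
Proof.
elim: n y => [|n IH] y yc cy; first by rewrite mkseqS /= cy.
rewrite mkseqS [block _ _]/= ltNge yc //=.
by apply: IH => // k kn; exact: yc.
Qed.

Lemma first_passage (x : nat -> int) c : x 0%N <= c -> (exists n, c < x n) ->
  exists s, block c s /\ forall k, (k < size s)%N -> x k.+1 = nth 0 s k.
Proof.
move=> x0 ex; case: (ex_minnP ex) => -[|n] xn n_min; first by rewrite ltNge x0
  in xn.
exists (mkseq (fun k => x k.+1) n.+1); split; last first.
  by move=> k; rewrite size_mkseq => kn; rewrite nth_mkseq.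
apply: block_mkseq => // k kn; rewrite leNgt; apply/negP => /n_min.
by rewrite ltnS leqNgt kn.
Qed.

Lemma measure_full d (T : measurableType d) (R : realType) (mu : probability T
  R)
    (A B G : set T) : measurable A -> measurable B -> measurable G -> mu G =
      1%E ->
  (forall t, G t -> A t <-> B t) -> mu A = mu B.
Proof.
move=> mA mB mG G1 AB.
have GI C : measurable C -> mu C = mu (C `&` G).
  move=> mC; rewrite (measureDI mu mC mG) [X in (X + _)%E](_ : _ = 0%E)
    ?add0e//.
  apply/eqP; rewrite eq_le measure_ge0 andbT.
  apply: (@le_trans _ _ (mu (~` G))).
    by apply: le_measure; rewrite ?inE; [exact: measurableD|exact:
      measurableC|move=> t []].
  by rewrite probability_setC// G1 subee.
rewrite (GI A)// (GI B)//; congr (mu _).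
by apply/seteqP; split=> t [tt Gt]; split=> //; apply/AB.
Qed.

Lemma limn_esup_le0 (R : realType) (u : (\bar R)^nat) :
  (forall n, u n <= 0)%E -> (limn_esup u <= 0)%E.
Proof.
move=> u0; rewrite limn_esup_lim; apply: lime_le; first exact: is_cvg_esups.
by apply: nearW => n; apply: ge_ereal_sup => _ [k _ <-].
Qed.

(* The imaginary step from 1 to 0 is made sure by changing the environment at
   the site 1, which no path visits before [T_1]. *)
Definition with_ancestor (R : realType) (w : int -> int -> R) (x j : int) : R :=
  if x == 1 then (j == -1)%:R else w x j.

Lemma with_ancestor_env (R : realType) (w : int -> int -> R) :
  environment w -> environment (with_ancestor w).
Proof.
move=> we x; rewrite /with_ancestor; case: eqP => // _; split=> [j _|].
  exact: ler0n.
by rewrite !big_cons big_nil /= !add0r !addr0.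
Qed.

Lemma BS_with_ancestor (R : realType) (w : int -> int -> R) c x F :
  c <= 0 -> x <= c -> block_sum (with_ancestor w) c x F = block_sum w c x F.
Proof.
move=> c0 xc; apply: eq_esum => s /= bs; congr (_%:E * _)%E.
elim: s x xc bs => //= z s IH x xc; rewrite /with_ancestor (_ : (x == 1) =
  false); last first.
  by rewrite lt_eqF// (le_lt_trans xc)// (le_lt_trans c0).
by case: (ltP c z) => [_ /eqP -> //|zc /IH ->].
Qed.

Section Path.
Context {R : realType} {d : measure_display} {T : measurableType d}.
Context (w : int -> int -> R) (P : int -> probability T R) (X : nat -> T ->
  int).
Hypotheses (w_env : environment w) (X_walk : random_walk w P X).
Local Notation U := (excursion_counts X).

Lemma hitting_probE k i j : k <= i < j ->
  hitting_prob P X k i j = fine (block_sum w i k (fun s => indic (last k s ==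
    j))).
Proof.
move=> /andP[ki ij]; have [mE PE] := P_block w_env X_walk i k (fun s => last k
  s == j).
rewrite -PE /hitting_prob; congr fine.
have [_ /(_ k) X0 _] := X_walk.
apply: (measure_full _ mE _ X0); last 2 first.
- exact: measurable_X X_walk _ _.
- move=> t /= X0t; split=> [[_ [n [Xn Xle]]]|[s [bs /eqP ls cs]]].
    have [] := @first_passage (fun k => X k t) i; [by rewrite X0t|by exists n;
      rewrite Xn|].
    move=> s [bs xs]; have cs : cylinder X k s t by case=> [|m] //; exact: xs.
    exists s; split=> //.
    (* Both are the first time above [i]: the path is above [i] at time [n] and at no earlier
       time. *)
    have sn : size s = n.
      have lt_s m : (m < size s)%N -> (i < X m.+1 t) = (m.+1 == size s).
        by move=> ms; rewrite xs// block_nth.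
      have s0 : (0 < size s)%N by case: s bs {xs cs lt_s}.
      apply/eqP; rewrite eqn_leq; apply/andP; split.
        rewrite leqNgt; apply/negP => ns; case: n Xn Xle ns => [|n] Xn Xle ns.
          by rewrite -X0t Xn leNgt ij in ki.
        by have := lt_s n (ltnW ns); rewrite Xn ij ltn_eqF.
      rewrite leqNgt; apply/negP => /Xle; rewrite leNgt.
      by have := lt_s (size s).-1; rewrite prednK// eqxx => ->.
    by have := cs n; rewrite -sn leqnn -last_nth -Xn -sn => ->.
  split=> //; exists (size s); split=> [|m ms].
    by have := cs (size s) (leqnn _); rewrite -last_nth ls.
  case: m ms => [|m] ms; first by rewrite X0t.
  by rewrite (cs m.+1 (ltnW ms)) leNgt (block_nth bs (ltnW ms)) ltn_eqF.
have -> : [set t | i < j /\ exists n, X n t = j /\ forall m, (m < n)%N -> X m t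
  <= i] =
   \bigcup_n (X n @^-1` [set j] `&`
      \bigcap_(m in [set m | (m < n)%N]) X m @^-1` [set z | z <= i]).
  apply/seteqP; split=> [t [_ [n [Xn Xle]]]|t [n _ [Xn Xle]]].
    by exists n => //; split.
  by split=> //; exists n; split.
apply: bigcup_measurable => n _; apply: measurableI.
  exact: measurable_X X_walk _ _.
case: n => [|n].
  by rewrite (_ : mkset _ = set0) ?bigcap_set0//; apply/seteqP; split.
by apply: bigcap_measurable => [|m _]; [exists 0%N|exact: measurable_X X_walk _
  _].
Qed.

Hypothesis X_limsup :
  {ae P 0, forall t, limn_esup (fun n => ((X n t)%:~R : R)%:E) = +oo%E}.

Lemma BS_start : block_sum w 0 0 (fun=> 1%E) = 1%E.
Proof.
have [mE PE] := P_block w_env X_walk 0 0 (fun=> true).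
rewrite -[LHS]PE; set E := [set _ | _] in mE *.
have [_ /(_ 0) X0 _] := X_walk.
have mX0 : measurable (X 0%N @^-1` [set 0]) by exact: measurable_X X_walk _ _.
case: X_limsup => N [mN N0 badN].
(* A path from 0 that never becomes positive has limsup at most 0, so it lies in the exceptional
   null set. *)
have CE : P 0 (~` E) = 0%E.
  apply/eqP; rewrite eq_le measure_ge0 andbT.
  apply: (@le_trans _ _ (P 0 (N `|` ~` (X 0%N @^-1` [set 0])))).
    apply: le_measure; rewrite ?inE.
    - exact: measurableC.
    - by apply: measurableU => //; exact: measurableC.
    move=> t nE; apply: contrapT => /not_orP[nN /contrapT X0t]; apply: nE.
    have [||s [bs xs]] := @first_passage (fun k => X k t) 0.
    - by rewrite X0t.
    - apply: contrapT => /forallNP no; apply: nN; apply: badN => /= h.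
      have : (limn_esup (fun n => ((X n t)%:~R : R)%:E) <= 0)%E.
        apply: limn_esup_le0 => n; rewrite lee_fin lerz0 leNgt; apply/negP.
        exact: no.
      by rewrite h.
    - by exists s; split=> //; case=> [|m] //; exact: xs.
  apply: le_trans; first by apply: measureU2 => //; exact: measurableC.
  rewrite [X in (X + _)%E]N0 add0e [leLHS]probability_setC//. by rewrite X0
    subee.
have := probability_setC (P 0) mE; rewrite CE.
have := fin_num_measure (P 0) _ mE; case: (P 0 E) => // r _ [/eqP].
by rewrite eq_sym subr_eq0 => /eqP <-.
Qed.

(** Paths that never become positive are null, so [E] need only be described along blocks. The sum
    starts at 1, with the imaginary step as first letter. *)
Lemma P_path (E : set T) (Psi : pred (seq int)) : measurable E ->
  (forall t s, block 0 s -> cylinder X 0 s t -> E t <-> Psi (0 :: s)) ->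
  P 0 E = block_sum (with_ancestor w) 0 1 (fun q => indic (Psi q)).
Proof.
move=> mE EPsi.
have [mF PF] := P_block w_env X_walk 0 0 (fun s => Psi (0 :: s)).
have [mG PG] := P_block w_env X_walk 0 0 (fun=> true).
rewrite BS_step; [|exact: with_ancestor_env|by move=> s; exact: indic_ge0].
rewrite !big_cons big_nil /with_ancestor /= !mul0e !add0e !adde0 mul1e.
rewrite -/(with_ancestor w) BS_with_ancestor// -PF.
apply: (measure_full mE mF mG) => [|t [s [bs _ cs]]]; first by rewrite PG
  BS_start.
split=> [/(EPsi _ _ bs cs) Ps|[s' [bs' Ps' cs']]]; first by exists s.
exact/(EPsi _ _ bs' cs').
Qed.

Lemma U_word c s t : c <= 0 -> block 0 s -> cylinder X 0 s t ->
  U (c + 1) t = exc_count c 1 (0 :: s).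
Proof.
move=> c0 bs cs; apply: U_of_path_word => //; first exact: (cs 0%N).
by move=> k ks; exact: (cs k.+1).
Qed.

End Path.

(** * First block decomposition of an excursion *)

Section Exits.
Context {R : realType} (w : int -> int -> R) (w_env : environment w).
Local Notation BS := (block_sum w).

Definition exit_mass (c x : int) (k : nat) : R :=
  fine (BS c x (fun s => indic (exit_step c x s == Some (lstep c (inord k))))).

Lemma exit_massE c x k :
  (exit_mass c x k)%:E = BS c x (fun s => indic (exit_step c x s == Some (lstep
    c (inord k)))).
Proof. by rewrite fineK// BS_ind_fin. Qed.

Lemma exit_mass_ge0 c x k : 0 <= exit_mass c x k.
Proof. by rewrite -lee_fin exit_massE; apply: BS_ge0 => // s; exact: indic_ge0.
  Qed.

Definition unit9 (t : nat) : 'rV[nat]_9 := delta_mx ord0 (inord t).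

(** The first sub-block, at level [c - 1], either ends at [c], where everything restarts with one
    more child, or jumps from [c - 1] to [c + 1]. The latter leaves level [c] at the same moment, so
    sub-type 3 of a child forces sub-type 2 of its parent. *)
Lemma BS_first_block (c y x : int) m (g : option (int * int) -> 'rV[nat]_9 ->
  \bar R) :
  (m < 3)%N -> (y, x) = nth (0, 0) [:: (c, c - 1); (c, c - 2); (c + 1, c - 1)]
    m ->
  (forall e v, 0 <= g e v)%E ->
  BS c x (fun s => g (exit_step c x s) (exc_count (c - 1)%R y (x :: s))) =
  ((exit_mass (c - 1)%R x 0)%:E * BS c c (fun s => g (exit_step c c s)
       (unit9 (m * 3 + 0)%N + exc_count (c - 1)%R c s)%R) +
   (exit_mass (c - 1)%R x 1)%:E * BS c c (fun s => g (exit_step c c s)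
       (unit9 (m * 3 + 1)%N + exc_count (c - 1)%R c s)%R) +
   (exit_mass (c - 1)%R x 2)%:E * g (Some (c - 1, c + 1)%R) (unit9 (m * 3 +
     2)%N))%E.
Proof.
move=> m3 yx g0; have cc : c - 1 <= c by lia.
have xc : x <= c - 1 by move: m m3 yx => [|[|[|]]]//= _ [_ ->]; lia.
have xy : c - 1 < y by move: m m3 yx => [|[|[|]]]//= _ [-> _]; lia.
rewrite (BS_dec w_env _ cc); last by move=> s; exact: g0.
rewrite (BS_exit w_env xc); last first.
  by move=> b; case: ifP => // _; apply: BS_ge0 => // s; exact: g0.
have cntb k b : (k < 3)%N -> block (c - 1)%R b ->
    exit_step (c - 1)%R x b = Some (lstep (c - 1)%R (inord k)) ->
    exc_count (c - 1)%R y (x :: b) = unit9 (m * 3 + k)%N.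
  move=> k3 bb eb; apply/rowP => l; rewrite /unit9 !mxE /= xc xy
    (exc_types_block xc bb) cats0 eb.
  have [lf lk] := fstep_lstep_inord (c - 1)%R m3 k3.
  rewrite -lk (_ : (y, x) = fstep (c - 1)%R (inord (m * 3 + k))).
    by rewrite exc_type_step /= addn0 eq_sym; case: eqP.
  rewrite lf yx; move: m m3 {yx lf lk} => [|[|[|]]]//= _; congr (_, _); lia.
have last_c k b : (k < 2)%N -> block (c - 1)%R b ->
    exit_step (c - 1)%R x b = Some (lstep (c - 1)%R (inord k)) -> last x b = c.
  move=> k2 bb /(exit_last bb) ->; move: k k2 => [|[|]]//= _;
  by rewrite /lstep inordK//=; lia.
have inner k : (k < 2)%N ->
    BS (c - 1)%R x (fun b => indic (exit_step (c - 1)%R x b == Some (lstep (c -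
      1)%R (inord k))) *
      (if (c < last x b)%R then g (exit_step c x b) (exc_count (c - 1)%R y (x
        :: b))
       else BS c (last x b) (fun s => g (exit_step c x (b ++ s))
          (exc_count (c - 1)%R y (x :: b ++ s)))))%E =
    ((exit_mass (c - 1)%R x k)%:E * BS c c (fun s => g (exit_step c c s)
       (unit9 (m * 3 + k)%N + exc_count (c - 1)%R c s)%R))%E.
  move=> k2; rewrite exit_massE muleC -BSZ//; last 2 first.
  - by apply: BS_ge0 => // s; exact: g0.
  - by move=> s; exact: indic_ge0.
  apply: eq_BS => // b bb _; case: eqP => [eb|]; last by rewrite mule0 mul0e.
  rewrite (last_c _ _ k2 bb eb) ltxx mul1e mule1; apply: eq_BS => // s _ _.
  have [-> _] := skeleton s cc xc bb eb.
  have e2 : (lstep (c - 1)%R (inord k)).2 = c by rewrite -(exit_last bb eb)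
    (last_c _ _ k2 bb eb).
  rewrite e2 /= ltxx; congr g; rewrite -cat_cons exc_count_cat /=; last first.
    by rewrite (last_c _ _ k2 bb eb); lia.
  by rewrite (last_c _ _ k2 bb eb) (cntb k)// ltnW.
rewrite !big_ord_recr big_ord0 /= add0e (inner 0%N)// (inner 1%N)//; congr (_ +
  _)%E.
rewrite exit_massE muleC -BSZ//; last by move=> s; exact: indic_ge0.
apply: eq_BS => // b bb _; case: eqP => [eb|]; last by rewrite mule0 mul0e.
have e2 : lstep (c - 1)%R (inord 2) = (c - 1, c + 1).
  by rewrite /lstep inordK//=; congr (_, _); lia.
rewrite (exit_last bb eb) e2 /= ltrDl ltr01 mul1e mule1 (cntb 2%N)//.
have [] := skeleton [::] cc xc bb eb; rewrite cats0 e2 /= => -> _.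
by rewrite ltrDl ltr01.
Qed.

Lemma BS_at (c : int) (g : option (int * int) -> 'rV[nat]_9 -> \bar R) :
  (forall e v, 0 <= g e v)%E ->
  BS c c (fun s => g (exit_step c c s) (exc_count (c - 1)%R c s)) =
  ((w c (-2)%R)%:E *
     ((exit_mass (c - 1)%R (c - 2)%R 0)%:E * BS c c (fun s => g (exit_step c c
       s)
         (unit9 3 + exc_count (c - 1)%R c s)%R) +
      (exit_mass (c - 1)%R (c - 2)%R 1)%:E * BS c c (fun s => g (exit_step c c
        s)
         (unit9 4 + exc_count (c - 1)%R c s)%R) +
      (exit_mass (c - 1)%R (c - 2)%R 2)%:E * g (Some (c - 1, c + 1)%R) (unit9
        5)) +
   ((w c (-1)%R)%:E *
     ((exit_mass (c - 1)%R (c - 1)%R 0)%:E * BS c c (fun s => g (exit_step c c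
       s)
         (unit9 0 + exc_count (c - 1)%R c s)%R) +
      (exit_mass (c - 1)%R (c - 1)%R 1)%:E * BS c c (fun s => g (exit_step c c
        s)
         (unit9 1 + exc_count (c - 1)%R c s)%R) +
      (exit_mass (c - 1)%R (c - 1)%R 2)%:E * g (Some (c - 1, c + 1)%R) (unit9
        2)) +
   ((w c 1)%:E * g (Some (c, c + 1)%R) 0%R +
    (w c 2)%:E * g (Some (c, c + 2)%R) 0%R)))%E.
Proof.
move=> g0; rewrite {1}BS_step//.
rewrite !big_cons big_nil adde0.
have e1 : (c < c + -2) = false by lia.
have e2 : (c < c + -1) = false by lia.
have e3 : (c < c + 1) = true by lia.
have e4 : (c < c + 2) = true by lia.
have c3 z : c < z -> exc_count (c - 1)%R c [:: z] = 0.
  move=> cz; apply/rowP => l; rewrite !mxE /= [z <= _]leNgt (_ : c - 1 < z)//;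
    lia.
have exit_down z s : z < c -> exit_step c c (z :: s) = exit_step c z s.
  by move=> zc /=; rewrite ltNge ltW.
rewrite e1 e2 e3 e4 !c3// /= e3 e4; congr (_ * _ + (_ * _ + _))%E.
- have := @BS_first_block c c (c - 2)%R 1 g isT erefl g0; rewrite /= => <-.
  by apply: eq_BS => // s _ _; rewrite ltNge (_ : c + -2 <= c)//; lia.
- have := @BS_first_block c c (c - 1)%R 0 g isT erefl g0; rewrite /= => <-.
  by apply: eq_BS => // s _ _; rewrite ltNge (_ : c + -1 <= c)//; lia.
Qed.

End Exits.

(** * Linear equations for the exit masses *)

Section Linear.
Context {R : realType} (w : int -> int -> R) (w_env : environment w).
Local Notation BS := (block_sum w).
Local Notation exit_mass := (exit_mass w).
Implicit Types (c x : int) (k : nat) (Q : pred 'rV[nat]_9).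

(* [wA c k] and [wB c k] are the masses of the excursions at [c] of type A,
   respectively B, and subtype [k + 1]; subtypes 1 and 2 return to [c]. *)
Definition wA c k : R := w c (-1) * exit_mass (c - 1) (c - 1) k.
Definition wB c k : R := w c (-2) * exit_mass (c - 1) (c - 2) k.
Definition ret c : R := wA c 0 + wA c 1 + wB c 0 + wB c 1.

(** The inhomogeneous term: exits with no return to [c] before them. Exit 1 is made by a last child
    of sub-type 3, of type A or B, which [Q] has to see. *)
Definition base c k Q : R :=
  if k == 0%N then w c 1 * (Q 0)%:R else
  if k == 1%N then wA c 2 * (Q (unit9 2))%:R + wB c 2 * (Q (unit9 5))%:R else
  w c 2 * (Q 0)%:R.

Definition top_mass c k Q : R := fine (BS c c (fun s =>
  indic ((exit_step c c s == Some (lstep c (inord k))) && Q (exc_count (c - 1)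
    c s)))).

Definition below_mass c k Q : R := fine (BS c (c - 1) (fun s =>
  indic ((exit_step c (c - 1) s == Some (lstep c (inord k))) &&
    Q (exc_count (c - 1) (c + 1) (c - 1 :: s))))).

Lemma indicE (b : bool) : indic b = (b%:R : R)%:E. Proof. by case: b. Qed.

Lemma top_massE c k Q : (top_mass c k Q)%:E = BS c c (fun s =>
  indic ((exit_step c c s == Some (lstep c (inord k))) && Q (exc_count (c - 1)
    c s))).
Proof. by rewrite fineK// BS_ind_fin. Qed.

Lemma below_massE c k Q : (below_mass c k Q)%:E = BS c (c - 1) (fun s =>
  indic ((exit_step c (c - 1) s == Some (lstep c (inord k))) &&
    Q (exc_count (c - 1) (c + 1) (c - 1 :: s)))).
Proof. by rewrite fineK// BS_ind_fin. Qed.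

Lemma eq_top_mass c k Q Q' : Q =1 Q' -> top_mass c k Q = top_mass c k Q'.
Proof. by move=> e; congr fine; apply: eq_BS => // s _ _; rewrite e. Qed.

Lemma exit_mass_top c k : exit_mass c c k = top_mass c k predT.
Proof. by congr fine; apply: eq_BS => // s _ _; rewrite andbT. Qed.

Lemma top_mass_pred0 c k : top_mass c k pred0 = 0.
Proof.
rewrite /top_mass /block_sum esum1// => s _.
by rewrite andbF mule0.
Qed.

Lemma lstep_inord c k : (k < 3)%N -> lstep c (inord k) =
  nth (0, 0) [:: (c, c + 1); (c - 1, c + 1); (c, c + 2)] k.
Proof. by move=> k3; rewrite /lstep inordK ?modn_small//; lia. Qed.

Lemma eq_exit (p q : int * int) : (Some p == Some q) = (p.1 == q.1) && (p.2 ==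
  q.2).
Proof. by []. Qed.

Lemma top_mass_rec c k Q : (k < 3)%N -> top_mass c k Q =
  wA c 0 * top_mass c k (fun v => Q (unit9 0 + v)) +
  wA c 1 * top_mass c k (fun v => Q (unit9 1 + v)) +
  wB c 0 * top_mass c k (fun v => Q (unit9 3 + v)) +
  wB c 1 * top_mass c k (fun v => Q (unit9 4 + v)) + base c k Q.
Proof.
move=> k3; apply: EFin_inj.
have := @BS_at R w w_env c (fun e v => indic ((e == Some (lstep c (inord k)))
  && Q v))
  (fun e v => indic_ge0 _).
rewrite /= -!(top_massE c k Q) => ->.
rewrite -(top_massE c k (fun v => Q (unit9 0 + v))) -(top_massE c k (fun v => Q
  (unit9 1 + v))).
rewrite -(top_massE c k (fun v => Q (unit9 3 + v))) -(top_massE c k (fun v => Q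
  (unit9 4 + v))).
rewrite !indicE -?EFinM -?EFinD -?EFinM -?EFinD; congr EFin.
rewrite lstep_inord// !eq_exit /wA /wB /base.
have c1 : (c - 1 == c) = false by lia.
have c2 : (c == c - 1) = false by lia.
have c3 : (c + 1 == c + 2) = false by lia.
have c4 : (c + 2 == c + 1) = false by lia.
by case: k k3 => [|[|[|//]]] _ /=; rewrite ?eqxx ?c1 ?c2 ?c3 ?c4 /= ?eqxx ?c1
  ?c2 ?c3 ?c4 /=; rewrite ?/wA ?/wB; ring.
Qed.

Lemma below_mass_rec c k Q : (k < 3)%N -> below_mass c k Q =
  exit_mass (c - 1) (c - 1) 0 * top_mass c k (fun v => Q (unit9 6 + v)) +
  exit_mass (c - 1) (c - 1) 1 * top_mass c k (fun v => Q (unit9 7 + v)) +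
  exit_mass (c - 1) (c - 1) 2 * ((k == 1%N) && Q (unit9 8))%:R.
Proof.
move=> k3; apply: EFin_inj.
have := @BS_first_block R w w_env c (c + 1) (c - 1) 2
  (fun e v => indic ((e == Some (lstep c (inord k))) && Q v)) isT erefl
  (fun e v => indic_ge0 _).
rewrite /= -!(below_massE c k Q) => ->.
rewrite -(top_massE c k (fun v => Q (unit9 6 + v))) -(top_massE c k (fun v => Q
  (unit9 7 + v))).
rewrite !indicE -?EFinM -?EFinD -?EFinM -?EFinD; congr EFin.
rewrite lstep_inord// !eq_exit.
have c1 : (c - 1 == c) = false by lia.
by case: k k3 => [|[|[|//]]] _ /=; rewrite ?eqxx ?c1.
Qed.

Lemma wA_ge0 c k : 0 <= wA c k.
Proof. by rewrite mulr_ge0 ?(step_ge0 w_env) ?exit_mass_ge0. Qed.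

Lemma wB_ge0 c k : 0 <= wB c k.
Proof. by rewrite mulr_ge0 ?(step_ge0 w_env) ?exit_mass_ge0. Qed.

Lemma exit_mass_linear c k : (k < 3)%N ->
  exit_mass c c k * (1 - ret c) = base c k predT.
Proof.
move=> k3; rewrite exit_mass_top; have := @top_mass_rec c k predT k3.
rewrite -!/(top_mass c k predT) /ret => E; rewrite mulrBr mulr1 {1}E; ring.
Qed.

Lemma esum_top_mass c k : (\esum_(n in [set: nat])
   (top_mass c k (fun v => (\sum_j v ord0 j)%N == n))%:E = (exit_mass c c
     k)%:E)%E.
Proof.
under eq_esum do rewrite top_massE.
rewrite -BS_esum//; last by move=> n s; exact: indic_ge0.
rewrite exit_massE//; apply: eq_BS => // s _ _; case: (exit_step _ _ _ == _) =>
  /=.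
  by rewrite -[RHS](@esum_pick _ _ (\sum_j exc_count (c - 1) c s ord0 j)%N
    (fun=> 1%E)).
by rewrite esum1.
Qed.

Lemma sum_unit9D t (v : 'rV[nat]_9) :
  (\sum_j (unit9 t + v)%R ord0 j = (\sum_j v ord0 j).+1)%N.
Proof.
under eq_bigr do rewrite mxE; rewrite big_split /= -[RHS]add1n; congr (_ + _)%N.
rewrite (bigD1 (inord t)) //= big1 => [|j jt]; rewrite !mxE ?eqxx //=.
by rewrite (negbTE jt).
Qed.

Lemma base_eq0 c k Q : base c k predT = 0 -> base c k Q = 0.
Proof.
rewrite /base !mulr1; case: ifP => _; first by move=> ->; rewrite mul0r.
case: ifP => _; last by move=> ->; rewrite mul0r.
move=> /eqP; rewrite paddr_eq0 ?wA_ge0 ?wB_ge0// => /andP[/eqP -> /eqP ->].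
by rewrite !mul0r addr0.
Qed.

(* If the walk returns surely, it never exits: the return equation alone
   does not see it, the number of excursions before the exit does. *)
Lemma exit_mass_ret1 c k : (k < 3)%N -> ret c = 1 -> exit_mass c c k = 0.
Proof.
move=> k3 r1; have b0 : base c k predT = 0 by rewrite -exit_mass_linear// r1
  subrr mulr0.
apply: EFin_inj; rewrite -esum_top_mass esum1// => n _; congr EFin.
elim: n => [|n IH].
  (* A return adds a child, so with no child at all only the base term could contribute. *)
  have Z t : top_mass c k (fun v => (\sum_j (unit9 t + v)%R ord0 j)%N == 0%N) =
    0.
    by rewrite -(top_mass_pred0 c k); apply: eq_top_mass => v; rewrite
      sum_unit9D.
  by rewrite top_mass_rec// base_eq0// !Z !mulr0 !addr0.
have Z t : top_mass c k (fun v => (\sum_j (unit9 t + v)%R ord0 j)%N == n.+1) =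
  0.
  by rewrite -IH; apply: eq_top_mass => v; rewrite sum_unit9D.
by rewrite top_mass_rec// base_eq0// !Z !mulr0 !addr0.
Qed.

End Linear.

(** * The indices *)

Section Reach.
Context {R : realType} (w : int -> int -> R) (w_env : environment w).
Local Notation BS := (block_sum w).
Local Notation exit_mass := (exit_mass w).
Implicit Types (c x : int) (k : nat).

Lemma exit_mass_prev c k : (k < 3)%N -> exit_mass c (c - 1) k =
  (exit_mass (c - 1) (c - 1) 0 + exit_mass (c - 1) (c - 1) 1) * exit_mass c c k
    +
  exit_mass (c - 1) (c - 1) 2 * (k == 1%N)%:R.
Proof.
move=> k3; have -> : exit_mass c (c - 1) k = below_mass w c k predT.
  by congr fine; apply: eq_BS => // s _ _; rewrite andbT.
rewrite below_mass_rec//= andbT.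
have -> : exit_mass c c k = top_mass w c k predT by exact: exit_mass_top.
by rewrite mulrDl.
Qed.

Lemma BS_exits c x : x <= c ->
  BS c x (fun=> 1%E) = (exit_mass c x 0 + exit_mass c x 1 + exit_mass c x 2)%:E.
Proof.
move=> xc; rewrite (BS_exit w_env xc)//.
rewrite !big_ord_recr big_ord0 /= add0e 2!EFinD !exit_massE//.
by congr (_ + _ + _)%E; apply: eq_BS => // s _ _; rewrite mule1.
Qed.

Lemma BS_last c x : x <= c ->
  fine (BS c x (fun s => indic (last x s == c + 1))) = exit_mass c x 0 +
    exit_mass c x 1.
Proof.
move=> xc; rewrite (BS_exit w_env xc); last by move=> s; exact: indic_ge0.
rewrite !big_ord_recr big_ord0 /= add0e.
have E k : (k < 3)%N -> BS c x (fun s =>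
    indic (exit_step c x s == Some (lstep c (inord k))) * indic (last x s == c
      + 1)%R)%E =
    ((k != 2%N)%:R * exit_mass c x k)%:E.
  move=> k3; rewrite EFinM exit_massE// -BSZ ?lee_fin//; last by move=> s;
    exact: indic_ge0.
  apply: eq_BS => // s bs _; case: eqP => [es|]; last by rewrite mul0e mule0.
  rewrite (exit_last bs es) lstep_inord// mul1e mule1.
  by case: k k3 {es} => [|[|[|//]]] _ /=; rewrite ?eqxx//= (_ : (c + 2 == c +
    1) = false)//; lia.
by rewrite !E// -!EFinD /= !mul1r mul0r addr0.
Qed.

(** The limsup hypothesis yields this at the starting point only; a site never visited may lack
    it. *)
Definition reach x := BS 0 x (fun=> 1%E) = 1%E.

Lemma BS1_fin c x : BS c x (fun=> 1%E) \is a fin_num.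
Proof. exact: (@BS_ind_fin _ w w_env c x (fun=> true)). Qed.

(** A convex combination of numbers at most 1 equals 1 only if all entries of positive weight are
    1. *)
Lemma reach_step x j : reach x -> j \in steps -> 0 < w x j -> x + j <= 0 ->
  reach (x + j).
Proof.
rewrite /reach BS_step// => tot js wj xj.
pose a (i : int) : R := if 0 < x + i then 1 else fine (BS 0 (x + i) (fun=>
  1%E)).
have aE i : (if 0 < x + i then 1%E else BS 0 (x + i) (fun=> 1%E)) = (a i)%:E.
  by rewrite /a; case: ifP => // _; rewrite fineK// BS1_fin.
have a1 i : a i <= 1.
  by rewrite -lee_fin -aE; case: ifP => // _; exact: BS_le1.
have sum0 : \sum_(i <- steps) w x i * (1 - a i) = 0.
  under eq_bigr do rewrite mulrBr mulr1.
  rewrite sumrB (w_env x).2; apply/eqP; rewrite subr_eq0; apply/eqP.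
  apply: EFin_inj; rewrite -tot -sumEFin; apply: eq_bigr => i _.
  by rewrite aE EFinM.
have := sum0; rewrite (big_rem j js) => /eqP; rewrite paddr_eq0; last 2 first.
- by rewrite mulr_ge0 ?(step_ge0 w_env)// subr_ge0.
- rewrite big_seq; apply: sumr_ge0 => i /(@mem_rem _ j steps i) is_; rewrite
  mulr_ge0 ?(step_ge0 w_env)//.
  by rewrite subr_ge0.
case/andP => + _; rewrite mulf_eq0 gt_eqF//= subr_eq0 => /eqP aj.
by have := aE j; rewrite ltNge xj /= -aj.
Qed.

Lemma reach_word c x s : c <= 0 -> reach x -> block c s -> 0 < weight w x s ->
  last x s <= 0 -> reach (last x s).
Proof.
move=> c0; elim: s x => //= z s IH x rx.
case: (boolP (z - x \in steps)) => zx; last by rewrite mul0r ltxx.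
move=> bs; rewrite lt_def mulf_eq0 negb_or -andbA => /and3P[w0 wt0 _] ls.
have wpos : 0 < w x (z - x) by rewrite lt_def w0 (step_ge0 w_env).
have wtpos : 0 < weight w z s by rewrite lt_def wt0 weight_ge0.
have rz : z <= 0 -> reach z.
  by move=> z0; have := @reach_step x (z - x) rx zx wpos; rewrite subrKC; exact.
move: bs; case: (ltP c z) => [_ /eqP s0|zc bs].
  by move: ls; rewrite s0 /=; exact: rz.
by apply: IH => //; apply: rz; exact: le_trans c0.
Qed.

Lemma reach_exits c x : x <= c -> c <= 0 -> reach x ->
  exit_mass c x 0 + exit_mass c x 1 + exit_mass c x 2 = 1.
Proof.
move=> xc c0 rx; apply: EFin_inj; rewrite -BS_exits//.
apply/eqP; rewrite eq_le BS_le1//= -[leLHS]rx (BS_dec w_env _ c0)//.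
apply: le_BS => // [s|s _ _]; first by case: ifP => // _; exact: BS_ge0.
by case: ifP => // _; exact: BS_le1.
Qed.

Lemma ret_neq1 c : c <= 0 -> reach c -> 1 - ret w c != 0.
Proof.
move=> c0 rc; rewrite subr_eq0 eq_sym; apply/eqP => r1.
have := reach_exits (lexx c) c0 rc.
by rewrite !exit_mass_ret1// !addr0 => /eqP; rewrite eq_sym oner_eq0.
Qed.

Lemma exit_mass_gt0_reach c x k : (k < 2)%N -> x <= c -> c + 1 <= 0 -> reach x
  ->
  0 < exit_mass c x k -> reach (c + 1).
Proof.
move=> k2 xc c0 rx; rewrite -lte_fin exit_massE// => /esum_gt0[|s /= bs].
  by move=> s _; rewrite mule_ge0 ?weight_ge0E ?indic_ge0.
have wt0 := weight_ge0 w_env x s.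
case: eqP => [es|]; last by rewrite mule0 ltxx.
rewrite mule1 lte_fin => wpos.
have ls : last x s = c + 1.
  rewrite (exit_last bs es) lstep_inord; last exact: leq_trans k2 _.
  by case: k k2 {es} => [|[|]].
rewrite -ls; apply: (@reach_word c) => //; last by rewrite ls.
by apply: le_trans c0; rewrite lerDl.
Qed.

(** [f] stays abstract because it will be the hitting probability of the original walk, whereas the
    masses are taken in the environment with ancestor. *)
Variable f : int -> int -> int -> R.
Hypothesis fE : forall x c, x <= c <= 0 -> f x c (c + 1) = exit_mass c x 0 +
  exit_mass c x 1.

(** The two subtracted terms of [d_] describe leaving [i - 1] downwards and coming back to exactly
    [i - 1]. *)
Lemma d_E i : i <= 1 -> d_ w f i = 1 - ret w (i - 1).
Proof.
move=> i1; rewrite /d_ (_ : i - 2 = i - 1 - 1); last lia.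
have := @fE (i - 1 - 1) (i - 1 - 1); rewrite subrK => ->; last lia.
have := @fE (i - 3) (i - 1 - 1); rewrite subrK => ->; last lia.
rewrite /ret /wA /wB (_ : i - 1 - 2 = i - 3); last lia.
ring.
Qed.

Lemma mul_div_exit_mass (a : R) i k : (k < 3)%N -> i <= 1 -> a = 0 \/ reach (i
  - 1) ->
  a * base w (i - 1) k predT / d_ w f i = a * exit_mass (i - 1) (i - 1) k.
Proof.
move=> k3 i1 [->|r1]; first by rewrite !mul0r.
rewrite d_E// -exit_mass_linear// mulrA mulfK// ret_neq1//; lia.
Qed.

Section Indices.
Variable i : int.
Hypothesis i0 : i <= 0.

(** [alpha2] is defined as a remainder; it is a mass because the three exits from [i - 1] have total
    1, by [reach]. *)
Lemma alphaE : w i (-1) = 0 \/ reach (i - 1) ->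
  [/\ alpha1 w f i = wA w i 0, alpha2 w f i = wA w i 1 & alpha3 w f i = wA w i
    2].
Proof.
move=> h; have i1 : i <= 1 by lia.
have a1 : alpha1 w f i = wA w i 0.
  by rewrite -[RHS](@mul_div_exit_mass _ i 0)// /base /= mulr1.
have a3 : alpha3 w f i = wA w i 2.
  by rewrite -[RHS](@mul_div_exit_mass _ i 2)// /base /= mulr1.
split=> //; rewrite /alpha2 a1 a3 /wA.
case: h => [->|r1]; first by rewrite !mul0r !subr0.
have := reach_exits (lexx (i - 1)) _ r1.
move=> h; have {}h : exit_mass (i - 1) (i - 1) 1 = 1 - exit_mass (i - 1) (i -
  1) 0 - exit_mass (i - 1) (i - 1) 2.
  by rewrite -h; [ring|lia].
by rewrite h; ring.
Qed.

Lemma gammaE : w (i + 1) (-2) = 0 \/ reach (i - 1) ->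
  [/\ gamma1 w f i = w (i + 1) (-2) * exit_mass (i - 1) (i - 1) 0,
      gamma2 w f i = w (i + 1) (-2) * exit_mass (i - 1) (i - 1) 1
    & gamma3 w f i = w (i + 1) (-2) * exit_mass (i - 1) (i - 1) 2].
Proof.
move=> h; have i1 : i <= 1 by lia.
have a1 : gamma1 w f i = w (i + 1) (-2) * exit_mass (i - 1) (i - 1) 0.
  by rewrite -[RHS](@mul_div_exit_mass _ i 0)// /base /= mulr1.
have a3 : gamma3 w f i = w (i + 1) (-2) * exit_mass (i - 1) (i - 1) 2.
  by rewrite -[RHS](@mul_div_exit_mass _ i 2)// /base /= mulr1.
split=> //; rewrite /gamma2 a1 a3.
case: h => [->|r1]; first by rewrite !mul0r !subr0.
have := reach_exits (lexx (i - 1)) _ r1.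
move=> h; have {}h : exit_mass (i - 1) (i - 1) 1 = 1 - exit_mass (i - 1) (i -
  1) 0 - exit_mass (i - 1) (i - 1) 2.
  by rewrite -h; [ring|lia].
by rewrite h; ring.
Qed.

(** From [i - 2] the walk first hits [i - 1], which explains the factor [f], or jumps from [i - 2]
    to [i]; the latter is sub-type 2 and enters only the remainder [beta2]. *)
Lemma betaE : w i (-2) = 0 \/ reach (i - 2) ->
  [/\ beta1 w f i = wB w i 0, beta2 w f i = wB w i 1 & beta3 w f i = wB w i 2].
Proof.
move=> h; have i1 : i <= 1 by lia.
pose a := w i (-2) * f (i - 2) (i - 2) (i - 1).
have fi : f (i - 2) (i - 2) (i - 1) = exit_mass (i - 2) (i - 2) 0 + exit_mass
  (i - 2) (i - 2) 1.
  by rewrite -fE; [congr f; lia|lia].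
have prev k : (k < 3)%N -> exit_mass (i - 1) (i - 2) k =
    f (i - 2) (i - 2) (i - 1) * exit_mass (i - 1) (i - 1) k + exit_mass (i - 2)
      (i - 2) 2 * (k == 1%N)%:R.
  move=> k3; have := @exit_mass_prev (i - 1) k k3.
  by rewrite fi (_ : i - 1 - 1 = i - 2)//; lia.
(* If the factor [f] is positive, [i - 1] is visited from [i - 2] with positive probability and
   inherits [reach]. *)
have ha : a = 0 \/ reach (i - 1).
  case: h => [w0|r2]; first by left; rewrite /a w0 mul0r.
  have [f0|fpos] := eqVneq (f (i - 2) (i - 2) (i - 1)) 0; first by left;
    rewrite /a f0 mulr0.
  right; rewrite (_ : i - 1 = i - 2 + 1); last lia.
  have : (0 < exit_mass (i - 2) (i - 2) 0) || (0 < exit_mass (i - 2) (i - 2) 1).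
    rewrite !lt_def !exit_mass_ge0// !andbT -negb_and; apply: contra fpos.
    by rewrite fi => /andP[/eqP -> /eqP ->]; rewrite addr0.
  by case/orP; apply: exit_mass_gt0_reach => //; lia.
have a1 : beta1 w f i = wB w i 0.
  rewrite /wB prev// mulr0 addr0 mulrA -/a -[RHS](@mul_div_exit_mass _ i 0)//.
  by rewrite /base /= mulr1.
have a3 : beta3 w f i = wB w i 2.
  rewrite /wB prev// mulr0 addr0 mulrA -/a -[RHS](@mul_div_exit_mass _ i 2)//.
  by rewrite /base /= mulr1.
split=> //; rewrite /beta2 a1 a3 /wB.
case: h => [->|r2]; first by rewrite !mul0r !subr0.
have h : exit_mass (i - 1) (i - 2) 0 + exit_mass (i - 1) (i - 2) 1 + exit_mass
  (i - 1) (i - 2) 2 = 1.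
  by apply: reach_exits => //; lia.
have {}h : exit_mass (i - 1) (i - 2) 1 = 1 - exit_mass (i - 1) (i - 2) 0 -
  exit_mass (i - 1) (i - 2) 2.
  by rewrite -h; ring.
by rewrite h; ring.
Qed.

End Indices.
End Reach.

(** * The offspring laws *)

Lemma unit9D_row9 s t (v : 'rV[nat]_9) : size s = 9%N -> (t < 9)%N ->
  (unit9 t + v == row9 s) =
  if nth 0%N s t is n.+1 then v == row9 (set_nth 0%N s t n) else false.
Proof.
move=> s9 t9; have tt : (inord t : 'I_9) = t :> nat by exact: inordK.
have uE j : unit9 t ord0 j = (j == t :> nat) :> nat.
  by rewrite mxE eqxx /= -val_eqE /= tt; case: eqP.
case st : (nth 0%N s t) => [|n].
  apply/eqP => /rowP /(_ (inord t)); rewrite mxE uE mxE tt eqxx st.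
  by [].
apply/eqP/eqP => /rowP h; apply/rowP => j; have := h j.
  rewrite mxE uE mxE => hj; rewrite mxE nth_set_nth /=; move: hj.
  by case: eqP => [->|_ //]; rewrite st => -[].
rewrite mxE nth_set_nth /= => hj; rewrite mxE uE mxE hj.
by case: eqP => [->|//]; rewrite st.
Qed.

Lemma eq0_row9 s : size s = 9%N -> (0 == row9 s) = all (pred1 0%N) s.
Proof.
move=> s9; apply/eqP/(all_nthP 0%N) => [/rowP h n|h].
  rewrite s9 => n9; have := h (Ordinal n9); rewrite !mxE /= => <-.
  by [].
by apply/rowP => j; rewrite !mxE; apply/esym/eqP/h; rewrite s9.
Qed.

Lemma unit9_row9 s t : size s = 9%N -> (t < 9)%N -> (unit9 t == row9 s) =
  if nth 0%N s t is m.+1 then all (pred1 0%N) (set_nth 0%N s t m) else false.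
Proof.
move=> s9 t9; rewrite -[unit9 t]addr0 unit9D_row9//.
case E : (nth 0%N s t) => [//|m]; rewrite eq0_row9// size_set_nth s9.
by apply/maxn_idPr.
Qed.

Section Multinomial.
Context {R : realType} (x y z t : R).

Definition multinomial_term (a b c d : nat) : R :=
  ((a + b + c + d)`!)%:R / (a`! * b`! * c`! * d`!)%:R *
  x ^+ a * y ^+ b * z ^+ c * t ^+ d.

Lemma multinomial_term0 : multinomial_term 0 0 0 0 = 1.
Proof. by rewrite /multinomial_term !expr0 !mulr1 divff. Qed.

Lemma multinomial_term_rec a b c d : (0 < a + b + c + d)%N ->
  multinomial_term a b c d =
  (if a is a'.+1 then x * multinomial_term a' b c d else 0) +
  (if b is b'.+1 then y * multinomial_term a b' c d else 0) +
  (if c is c'.+1 then z * multinomial_term a b c' d else 0) +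
  (if d is d'.+1 then t * multinomial_term a b c d' else 0).
Proof.
move=> n0; set n := (a + b + c + d)%N in n0 *.
(* The multinomial term divided by [n]: the four summands are [a], [b], [c], [d] times [m], and
   these counts add up to [n]. *)
pose m := n.-1`!%:R / (a`! * b`! * c`! * d`!)%:R * x ^+ a * y ^+ b * z ^+ c * t
  ^+ d : R.
have fact_neq0 k : (k`!)%:R != 0 :> R by rewrite pnatr_eq0 -lt0n fact_gt0.
have S_neq0 k : k.+1%:R != 0 :> R by rewrite pnatr_eq0.
have Ea : (if a is a'.+1 then x * multinomial_term a' b c d else 0) = a%:R * m.
  rewrite /m /n; case: a {n0 m n} => [|a]; first by rewrite mul0r.
  rewrite /multinomial_term !addSn /= factS exprS !natrM; field.
  by rewrite !fact_neq0 nat1r S_neq0.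
have Eb : (if b is b'.+1 then y * multinomial_term a b' c d else 0) = b%:R * m.
  rewrite /m /n; case: b {n0 m n Ea} => [|b]; first by rewrite mul0r.
  rewrite /multinomial_term addnS !addSn /= factS exprS !natrM; field.
  by rewrite !fact_neq0 nat1r S_neq0.
have Ec : (if c is c'.+1 then z * multinomial_term a b c' d else 0) = c%:R * m.
  rewrite /m /n; case: c {n0 m n Ea Eb} => [|c]; first by rewrite mul0r.
  rewrite /multinomial_term addnS !addSn /= factS exprS !natrM; field.
  by rewrite !fact_neq0 nat1r S_neq0.
have Ed : (if d is d'.+1 then t * multinomial_term a b c d' else 0) = d%:R * m.
  rewrite /m /n; case: d {n0 m n Ea Eb Ec} => [|d]; first by rewrite mul0r.
  rewrite /multinomial_term addnS /= factS exprS !natrM; field.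
  by rewrite !fact_neq0 nat1r S_neq0.
rewrite Ea Eb Ec Ed -!mulrDl -!natrD -/n /m /multinomial_term -/n -{1}(prednK
  n0) factS (prednK n0).
by rewrite natrM !mulrA.
Qed.

End Multinomial.

Section Formulas.
Context {R : realType} (w : int -> int -> R) (w_env : environment w).
Local Notation BS := (block_sum w).
Local Notation exit_mass := (exit_mass w).
Implicit Types (i : int) (k : nat).

Definition children_weight i := multinomial_term (wA w i 0) (wA w i 1) (wB w i
  0) (wB w i 1).

Lemma top_mass_unit9 i k s t : size s = 9%N -> (t < 9)%N ->
  top_mass w i k (fun v => pred1 (row9 s) (unit9 t + v)) =
  if nth 0%N s t is m.+1 then top_mass w i k (pred1 (row9 (set_nth 0%N s t m)))
    else 0.
Proof.
move=> s9 t9; transitivity (top_mass w i k (fun v =>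
    if nth 0%N s t is m.+1 then v == row9 (set_nth 0%N s t m) else false)).
  by apply: eq_top_mass => // v; rewrite /= unit9D_row9.
by case: (nth 0%N s t) => [|m] //; exact: top_mass_pred0.
Qed.

(** Returning children of the four kinds may come in any order, which the multinomial coefficient
    counts; [p] and [q] concern the child that makes the exit. *)
Lemma top_mass_row9 i k a b p c d q : (k < 3)%N ->
  top_mass w i k (pred1 (row9 [:: a; b; p; c; d; q; 0; 0; 0]%N)) =
  children_weight i a b c d * base w i k (pred1 (row9 [:: 0; 0; p; 0; 0; q; 0;
    0; 0]%N)).
Proof.
move=> k3; have [n] := ubnP (a + b + c + d); elim: n a b c d => // n IH a b c d
  abcd.
rewrite top_mass_rec// !top_mass_unit9//=.
have [n0|n0] := posnP (a + b + c + d).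
  have [-> [-> [-> ->]]] : a = 0%N /\ b = 0%N /\ c = 0%N /\ d = 0%N by lia.
  by rewrite !mulr0 !add0r /children_weight multinomial_term0 mul1r.
(* The base term allows no returning child, so it vanishes as long as one is left. *)
rewrite [X in _ + X](_ : _ = 0) ?addr0.
  rewrite /children_weight multinomial_term_rec// !mulrDl.
  congr (_ + _ + _ + _).
  - case: a abcd {n0} => [|m] abcd; first by rewrite mulr0 mul0r.
    by rewrite IH ?mulrA//; lia.
  - case: b abcd {n0} => [|m] abcd; first by rewrite mulr0 mul0r.
    by rewrite IH ?mulrA//; lia.
  - case: c abcd {n0} => [|m] abcd; first by rewrite mulr0 mul0r.
    by rewrite IH ?mulrA//; lia.
  - case: d abcd {n0} => [|m] abcd; first by rewrite mulr0 mul0r.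
    by rewrite IH ?mulrA//; lia.
rewrite /base /= !unit9_row9// eq0_row9//=.
have : [|| a != 0, b != 0, c != 0 | d != 0]%N by lia.
clear IH; case/or4P => /negbTE h; rewrite !h; case: p => [|p]; case: q => [|q];
  by rewrite /= ?andbF ?mulr0 ?addr0 !if_same.
Qed.

End Formulas.

Section LawFormulas.
Context {R : realType} (w : int -> int -> R) (w_env : environment w).
Context (f : int -> int -> int -> R).
Local Notation exit_mass := (exit_mass w).
Hypothesis fE : forall x c, x <= c <= 0 -> f x c (c + 1) = exit_mass c x 0 +
  exit_mass c x 1.
Implicit Types (i : int) (k : nat).

Lemma lstep_mod i (l : 'I_9) : lstep i (inord (l %% 3)) = lstep i l.
Proof. by rewrite /lstep inordK ?modn_mod//; have := ltn_mod l 3; lia. Qed.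

(** Types A and C both enter at [i], by a step that starts no excursion one level down; hence their
    common offspring law. *)
Lemma law_AC i (l : 'I_9) v : (l %/ 3)%N != 1%N -> mass w i l != 0%E ->
  exit_mass i i (l %% 3) != 0 /\
  law w i l v = top_mass w i (l %% 3) (pred1 v) / exit_mass i i (l %% 3).
Proof.
move=> l3 m0.
have x_i : (fstep i l).2 = i.
  have : (l %/ 3 < 3)%N by rewrite ltn_divLR.
  by rewrite /fstep; case: (l %/ 3)%N l3 => [|[|[|]]].
have mE : mass w i l = (exit_mass i i (l %% 3))%:E by rewrite /mass
  exit_massE// x_i lstep_mod.
have jE : joint w i l v = (top_mass w i (l %% 3) (pred1 v))%:E.
  rewrite /joint top_massE// x_i lstep_mod; apply: eq_BS => // s _ _.
  congr (indic (_ && (_ == _))); apply/rowP => j.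
  by rewrite !mxE /= [i <= _]leNgt (_ : i - 1 < i)//; lia.
split; first by move: m0; rewrite mE.
by rewrite /law (negbTE m0) mE jE.
Qed.

Lemma law_B i (l : 'I_9) v : (l %/ 3)%N = 1%N -> mass w i l != 0%E ->
  exit_mass i (i - 1) (l %% 3) != 0 /\
  law w i l v = below_mass w i (l %% 3) (pred1 v) / exit_mass i (i - 1) (l %%
    3).
Proof.
move=> l3 m0.
have fl : fstep i l = (i + 1, i - 1) by rewrite /fstep l3.
have mE : mass w i l = (exit_mass i (i - 1) (l %% 3))%:E.
  by rewrite /mass exit_massE// fl lstep_mod.
have jE : joint w i l v = (below_mass w i (l %% 3) (pred1 v))%:E.
  by rewrite /joint below_massE// fl lstep_mod.
split; first by move: m0; rewrite mE.
by rewrite /law (negbTE m0) mE jE.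
Qed.

Lemma reach_down i j : i <= 0 -> reach w i -> j \in steps -> j < 0 ->
  w i j = 0 \/ reach w (i + j).
Proof.
move=> i0 ri js j0; have [wj|wj] := eqVneq (w i j) 0; [by left|right].
apply: reach_step => //; last lia.
by rewrite lt_def wj step_ge0.
Qed.

Lemma pi_E i a b c d : i <= 0 -> reach w i ->
  pi_ w f i a b c d = children_weight w i a b c d * (1 - ret w i).
Proof.
move=> i0 ri.
have [a1 a2 _] := alphaE w_env fE i0 (reach_down (j := -1) i0 ri isT isT).
have [b1 b2 _] := betaE w_env fE i0 (reach_down (j := -2) i0 ri isT isT).
by rewrite /pi_ /children_weight /multinomial_term a1 a2 b1 b2 /ret; congr (_ *
  _); ring.
Qed.

Lemma alpha3_beta3E i : i <= 0 -> reach w i ->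
  alpha3 w f i = wA w i 2 /\ beta3 w f i = wB w i 2.
Proof.
move=> i0 ri.
have [_ _ a3] := alphaE w_env fE i0 (reach_down (j := -1) i0 ri isT isT).
by have [_ _ b3] := betaE w_env fE i0 (reach_down (j := -2) i0 ri isT isT).
Qed.

Lemma below_mass_row9 i k a b p c d q x y : (k < 3)%N ->
  below_mass w i k (pred1 (row9 [:: a; b; p; c; d; q; x; y; 0]%N)) =
  exit_mass (i - 1) (i - 1) 0 * (if x is x'.+1 then
     top_mass w i k (pred1 (row9 [:: a; b; p; c; d; q; x'; y; 0]%N)) else 0) +
  exit_mass (i - 1) (i - 1) 1 * (if y is y'.+1 then
     top_mass w i k (pred1 (row9 [:: a; b; p; c; d; q; x; y'; 0]%N)) else 0).
Proof.
move=> k3; rewrite below_mass_rec// /=.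
by rewrite !top_mass_unit9//= unit9_row9//= andbF mulr0 addr0.
Qed.

Lemma base_row9 i k p q : (k < 3)%N ->
  base w i k (pred1 (row9 [:: 0; 0; p; 0; 0; q; 0; 0; 0]%N)) =
  if k == 1%N then wA w i 2 * ((p == 1) && (q == 0))%N%:R + wB w i 2 * ((p ==
    0) && (q == 1))%N%:R
  else base w i k predT * ((p == 0) && (q == 0))%N%:R.
Proof.
rewrite /base /= !unit9_row9// eq0_row9//=; case: k => [|[|[|//]]] _ /=;
  rewrite ?mulr1 ?andbT//; case: p => [|[|p]]; case: q => [|[|q]];
  by rewrite /= ?eqSS ?andbF ?andbT.
Qed.

(** A type B excursion starts at [i - 1], but its formulas also involve the return factor at [i]. *)
Lemma reach_fstep_B i : i <= 0 -> reach w (i - 1) ->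
  exit_mass (i - 1) (i - 1) 0 + exit_mass (i - 1) (i - 1) 1 != 0 -> reach w i.
Proof.
move=> i0 r1 g0.
have : (0 < exit_mass (i - 1) (i - 1) 0) || (0 < exit_mass (i - 1) (i - 1) 1).
  rewrite !lt_def !exit_mass_ge0// !andbT -negb_and; apply: contra g0.
  by move=> /andP[/eqP -> /eqP ->]; rewrite addr0.
rewrite -[X in reach w X](subrK 1).
by case/orP; apply: exit_mass_gt0_reach => //; lia.
Qed.

Lemma law_formulas i (l : 'I_9) : i <= 0 -> mass w i l != 0%E ->
  reach w (fstep i l).2 ->
  ((l %/ 3)%N = 1%N -> i + 1 <= 0 /\ 0 < w (i + 1) (-2)) ->
  offspring_formulas w f i l (law w i l).
Proof.
move=> i0 m0 rx hB.
have AC : (l %/ 3)%N != 1%N -> reach w i.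
  have : (l %/ 3 < 3)%N by rewrite ltn_divLR.
  by move: rx; rewrite /fstep; case: (l %/ 3)%N => [|[|[|]]].
have Bx : (l %/ 3)%N = 1%N -> reach w (i - 1).
  by move=> l3; move: rx; rewrite /fstep l3.
have linear k : (k < 3)%N -> reach w i -> exit_mass i i k = base w i k predT /
  (1 - ret w i).
  by move=> k3 ri; rewrite -exit_mass_linear// mulfK// ret_neq1.
split.
- move=> lin a b c d.
  have [l3 k1] : (l %/ 3)%N != 1%N /\ (l %% 3 < 3)%N && (l %% 3 != 1)%N.
    by move: lin; rewrite !inE => /or4P[] /eqP; lia.
  have /andP[k3 {}k1] := k1; have ri := AC l3.
  have [e0 ->] := law_AC (row9 [:: a; b; 0; c; d; 0; 0; 0; 0]%N) l3 m0.
  have r0 := ret_neq1 w_env i0 ri.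
  rewrite top_mass_row9// base_row9// (negbTE k1) mulr1 pi_E//.
  rewrite -exit_mass_linear// -mulrA; congr (_ * _).
  by rewrite mulrAC mulfV// mul1r.
- move=> lin a b c d.
  have [l3 k1] : (l %/ 3)%N != 1%N /\ (l %% 3)%N = 1%N.
    by move: lin; rewrite !inE => /orP[] /eqP; lia.
  have ri := AC l3; have r0 := ret_neq1 w_env i0 ri.
  have [e0 _] := law_AC 0 l3 m0; have := linear 1%N isT ri.
  rewrite k1 in e0; have [-> ->] := alpha3_beta3E i0 ri.
  rewrite /base /= !mulr1 => E; rewrite E mulf_eq0 negb_or in e0.
  have /andP[b0 _] := e0.
  have lE p q : law w i l (row9 [:: a; b; p; c; d; q; 0; 0; 0]%N) =
      top_mass w i 1 (pred1 (row9 [:: a; b; p; c; d; q; 0; 0; 0]%N)) /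
        exit_mass i i 1.
    by have [_ ->] := law_AC (row9 [:: a; b; p; c; d; q; 0; 0; 0]%N) l3 m0;
      rewrite k1.
  by split; rewrite lE top_mass_row9// base_row9// pi_E// E /= ?mulr0 ?mulr1
    ?addr0 ?add0r;
    field; rewrite b0 r0.
- move=> lin a b c d.
  have [l3 k1] : (l %/ 3)%N = 1%N /\ (l %% 3 < 3)%N && (l %% 3 != 1)%N.
    by move: lin; rewrite !inE => /orP[] /eqP; lia.
  have /andP[k3 {}k1] := k1; have r1 := Bx l3; have [i10 w2] := hB l3.
  have w20 : w (i + 1) (-2) != 0 by rewrite gt_eqF.
  have [e0 _] := law_B 0 l3 m0.
  move: e0; rewrite exit_mass_prev// (negbTE k1) mulr0 addr0 mulf_eq0 negb_or
    => /andP[g0 e0].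
  have ri := reach_fstep_B i0 r1 g0; have r0 := ret_neq1 w_env i0 ri.
  have [-> -> _] := gammaE w_env fE i0 (or_intror r1).
  have E := linear _ k3 ri; rewrite E mulf_eq0 negb_or in e0.
  have /andP[b0 _] := e0.
  have lE x y : law w i l (row9 [:: a; b; 0; c; d; 0; x; y; 0]%N) =
      below_mass w i (l %% 3) (pred1 (row9 [:: a; b; 0; c; d; 0; x; y; 0]%N)) /
        exit_mass i (i - 1) (l %% 3).
    by have [_ ->] := law_B (row9 [:: a; b; 0; c; d; 0; x; y; 0]%N) l3 m0.
  by split; rewrite lE exit_mass_prev// (negbTE k1) mulr0 addr0
    below_mass_row9// top_mass_row9// base_row9//
    (negbTE k1) pi_E// E /= ?mulr0 ?mulr1 ?addr0 ?add0r -mulrDr;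
    field; rewrite b0 r0 g0 w20.
- move=> l4; have [l3 k1] : (l %/ 3)%N = 1%N /\ (l %% 3)%N = 1%N by lia.
  have r1 := Bx l3; have [i10 w2] := hB l3.
  have w20 : w (i + 1) (-2) != 0 by rewrite gt_eqF.
  have [e0 _] := law_B 0 l3 m0; rewrite k1 in e0.
  have [g1E g2E g3E] := gammaE w_env fE i0 (or_intror r1).
  (* The full mass of a type B excursion of sub-type 2, first step included: the denominator of the
     conditional law. *)
  have b2E : beta2 w f (i + 1) = w (i + 1) (-2) * exit_mass i (i - 1) 1.
    have [|_ -> _] := betaE w_env fE i10.
      by right; rewrite (_ : i + 1 - 2 = i - 1)//; lia.
    by rewrite /wB addrK (_ : i + 1 - 2 = i - 1)//; lia.
  split.
    have [_ ->] := law_B (row9 [:: 0; 0; 0; 0; 0; 0; 0; 0; 1]%N) l3 m0; rewrite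
      k1 b2E g3E.
    rewrite below_mass_rec// /=.
    (* Any other child would show in a coordinate that is 0 here; the type C child must jump out at
       once. *)
    have kq0 t : (t < 8)%N -> top_mass w i 1 (fun v => unit9 t + v == row9 [::
      0; 0; 0; 0; 0; 0; 0; 0; 1]%N) = 0.
      move=> t8; rewrite -[RHS](top_mass_pred0 w i 1); apply: eq_top_mass => //
        v.
      rewrite unit9D_row9//; last exact: ltnW.
      by case: t t8 => [|[|[|[|[|[|[|[|]]]]]]]].
    rewrite !kq0// !mulr0 !add0r -[unit9 8]addr0 unit9D_row9//= eq0_row9//=
      mulr1.
    by rewrite invfM mulrACA mulfV// mul1r.
  move=> a b c d.
  have lE p q x y : law w i l (row9 [:: a; b; p; c; d; q; x; y; 0]%N) =
      below_mass w i 1 (pred1 (row9 [:: a; b; p; c; d; q; x; y; 0]%N)) /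
        exit_mass i (i - 1) 1.
    by have [_ ->] := law_B (row9 [:: a; b; p; c; d; q; x; y; 0]%N) l3 m0;
      rewrite k1.
  rewrite !lE !below_mass_row9// !top_mass_row9// !base_row9//= !mulr0 !mulr1
    !addr0 !add0r.
  set g0 := exit_mass (i - 1) (i - 1) 0; set g1 := exit_mass (i - 1) (i - 1) 1.
  (* A denominator of [kappa] vanishes here, but then [gamma1], [gamma2] and the left-hand masses
     vanish as well. *)
  have [gz|gnz] := eqVneq (g0 + g1) 0.
    have [z0 z1] : g0 = 0 /\ g1 = 0.
      by move/eqP: gz; rewrite paddr_eq0 ?exit_mass_ge0// => /andP[/eqP -> /eqP
        ->].
    by rewrite g1E g2E -/g0 -/g1 z0 z1 !(mul0r, mulr0).
  have ri := reach_fstep_B i0 r1 gnz; have r0 := ret_neq1 w_env i0 ri.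
  have [a3 b3] := alpha3_beta3E i0 ri; have := linear 1%N isT ri.
  rewrite /base /= !mulr1 => E.
  (* By this relation the numerator of [kappa] is [(gamma1 + gamma2) * (alpha3 + beta3) / (1 -
     ret)], so [kappa] is [1 / (beta2 (i + 1) * (1 - ret))]; the return factor cancels against that
     of [pi_]. *)
  have g2m : exit_mass (i - 1) (i - 1) 2 = exit_mass i (i - 1) 1 -
      (g0 + g1) * ((wA w i 2 + wB w i 2) / (1 - ret w i)).
    by rewrite (@exit_mass_prev _ _ w_env i 1)// -/g0 -/g1 E mulr1; ring.
  rewrite /kappa b2E a3 b3 g1E g2E g3E -/g0 -/g1 g2m pi_E//.
  have [ABz|ABnz] := eqVneq (wA w i 2 + wB w i 2) 0.
    have [-> ->] : wA w i 2 = 0 /\ wB w i 2 = 0.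
      have A0 : 0 <= wA w i 2 by exact: wA_ge0.
      have B0 : 0 <= wB w i 2 by exact: wB_ge0.
      by move/eqP: ABz; rewrite paddr_eq0// => /andP[/eqP -> /eqP ->].
    by rewrite !(mul0r, mulr0).
  by split; rewrite -mulrDr; field; rewrite e0 r0 ABnz gnz w20.
Qed.

End LawFormulas.

(** * Conclusion *)

Lemma exit_prefix c z q e : exit_step c z q = Some e ->
  exists s q', [/\ q = s ++ q', block c s & exit_step c z s = Some e].
Proof.
elim: q z => //= u q IH z; case: (ltP c u) => cu.
  by move=> <-; exists [:: u], q; split; rewrite //= cu.
move=> /IH[s [q' [-> bs es]]]; exists (u :: s), q'.
by split; rewrite //= ltNge cu.
Qed.

Lemma delta_count_mem n (l : 'I_n) :
  delta_mx ord0 l = \row_l' count_mem l' [:: l] :> 'rV[nat]_n.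
Proof. by apply/rowP => j; rewrite !mxE /= eq_sym addn0; case: eqP. Qed.

Section Occurrence.
Context {R : realType} (w : int -> int -> R) (w_env : environment w).

(** All factors of a word of positive weight have positive weight, in particular the first step of
    the excursion and the stretch up to its exit. *)
Lemma occurring_type c y q l : c <= 0 -> reach w y -> block 0 q -> 0 < weight w
  y q ->
  l \in exc_types c y q ->
  [/\ mass w c l != 0%E, reach w (fstep c l).2 &
      0 < w (fstep c l).1 ((fstep c l).2 - (fstep c l).1)].
Proof.
move=> c0; elim: q y => [//|z q IH] y ry /=.
have [zy|zy] := boolP (z - y \in steps); last by rewrite mul0r ltxx.
move=> bq; rewrite lt_def mulf_eq0 negb_or -andbA => /and3P[w0 wt0 _]; move: bq.
have wpos : 0 < w y (z - y) by rewrite lt_def w0 step_ge0.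
have wtpos : 0 < weight w z q by rewrite lt_def wt0 weight_ge0.
case: (ltP 0 z) => [z0 /eqP ->|z0 bq]; first by rewrite leNgt (le_lt_trans c0).
have rz : reach w z by have := reach_step w_env ry zy wpos; rewrite subrKC;
  apply.
rewrite mem_cat => /orP[|]; last exact: IH.
case: ifP => // /andP[zc cy]; rewrite mem_filter => /andP[/andP[/eqP fl /eqP
  ll] _].
rewrite fl; split=> //; have [s [q' [qE bs es]]] := exit_prefix (esym ll).
rewrite gt_eqF//; apply: (@lt_le_trans _ _ (weight w z s)%:E).
  rewrite lte_fin lt_def weight_ge0// andbT; apply: contraTneq wtpos.
  by rewrite qE weight_cat => ->; rewrite mul0r ltxx.
rewrite /mass fl /=; have := @esum_ge_term R _ [set s | block c s]
   (fun s => (weight w z s)%:E * indic (exit_step c z s == Some (lstep c l)))%E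
     s.
rewrite es eqxx mule1; apply=> // s' _.
by rewrite mule_ge0 ?weight_ge0E ?indic_ge0.
Qed.

End Occurrence.

Section Transfer.
Context {R : realType} (w : int -> int -> R) (f : int -> int -> int -> R).

Lemma with_ancestorE x j : x <= 0 -> with_ancestor w x j = w x j.
Proof. by move=> x0; rewrite /with_ancestor lt_eqF//; apply: le_lt_trans x0 _.
  Qed.

Lemma d_with_ancestor i : i <= 1 -> d_ (with_ancestor w) f i = d_ w f i.
Proof. by move=> i1; rewrite /d_ !with_ancestorE//; lia. Qed.

Lemma alpha_beta_with_ancestor i : i <= 0 ->
  [/\ alpha1 (with_ancestor w) f i = alpha1 w f i,
      alpha2 (with_ancestor w) f i = alpha2 w f i
    & alpha3 (with_ancestor w) f i = alpha3 w f i] /\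
  [/\ beta1 (with_ancestor w) f i = beta1 w f i,
      beta2 (with_ancestor w) f i = beta2 w f i
    & beta3 (with_ancestor w) f i = beta3 w f i].
Proof.
move=> i0; have i1 : i - 1 <= 0 by lia.
have i2 : i <= 1 by lia.
by rewrite /alpha2 /beta2 /alpha1 /alpha3 /beta1 /beta3 !d_with_ancestor//
  !with_ancestorE.
Qed.

Lemma gamma_with_ancestor i : i + 1 <= 0 ->
  [/\ gamma1 (with_ancestor w) f i = gamma1 w f i,
      gamma2 (with_ancestor w) f i = gamma2 w f i
    & gamma3 (with_ancestor w) f i = gamma3 w f i].
Proof.
move=> i0; have i1 : i - 1 <= 0 by lia.
have i2 : i <= 1 by lia.
by rewrite /gamma2 /gamma1 /gamma3 !d_with_ancestor// !with_ancestorE.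
Qed.

(** Only the formulas for type B parents look at the site [i + 1]; the second hypothesis keeps it
    away from the altered site 1. *)
Lemma formulas_with_ancestor i (l : 'I_9) q : i <= 0 ->
  ((l %/ 3)%N = 1%N -> i + 1 <= 0) ->
  offspring_formulas (with_ancestor w) f i l q -> offspring_formulas w f i l q.
Proof.
move=> i0 hB [qa qb qc qd].
have [[a1 a2 a3] [b1 b2 b3]] := alpha_beta_with_ancestor i0.
have pE a b c d : pi_ (with_ancestor w) f i a b c d = pi_ w f i a b c d.
  by rewrite /pi_ a1 a2 b1 b2.
split.
- by move=> hl a b c d; rewrite -pE; exact: qa.
- by move=> hl a b c d; rewrite -pE -a3 -b3; exact: qb.
- move=> hl a b c d; have i10 : i + 1 <= 0.
    by apply: hB; move: hl; rewrite !inE => /orP[] /eqP; lia.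
  have [g1 g2 g3] := gamma_with_ancestor i10.
  by rewrite -pE -g1 -g2; exact: qc.
- move=> hl; have i10 : i + 1 <= 0 by apply: hB; lia.
  have [g1 g2 g3] := gamma_with_ancestor i10.
  have [_ [_ b2' _]] := alpha_beta_with_ancestor i10.
  have kE : kappa (with_ancestor w) f i = kappa w f i.
    by rewrite /kappa g1 g2 g3 b2' a3 b3.
  have [q1 q2] := qd hl; rewrite -g3 -b2'; split=> // a b c d.
  by rewrite -pE -kE -g1 -g2 -a3 -b3; exact: q2.
Qed.

End Transfer.

Section Main.
Context {R : realType} {d : measure_display} {T : measurableType d}.
Context (w : int -> int -> R) (P : int -> probability T R) (X : nat -> T ->
  int).
Hypotheses (w_env : environment w) (X_walk : random_walk w P X).
Hypothesis X_limsup :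
  {ae P 0, forall t, limn_esup (fun n => ((X n t)%:~R : R)%:E) = +oo%E}.
Local Notation U := (excursion_counts X).
Local Notation f := (hitting_prob P X).
Local Notation ws := (with_ancestor w).

Let ws_env : environment ws := with_ancestor_env w_env.

Lemma hitting_exit_mass x c : x <= c <= 0 -> f x c (c + 1) = exit_mass ws c x 0
  + exit_mass ws c x 1.
Proof.
move=> /andP[xc c0]; rewrite (hitting_probE w_env X_walk); last by rewrite xc
  ltrDl.
by rewrite -BS_last// BS_with_ancestor.
Qed.

Lemma reach0 : reach ws 0.
Proof. by rewrite /reach BS_with_ancestor// (BS_start w_env X_walk X_limsup).
  Qed.

Lemma BS_ancestor F : (forall s, 0 <= F s)%E ->
  block_sum ws 0 1 F = block_sum ws 0 0 (fun s => F (0 :: s)).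
Proof.
move=> F0; rewrite BS_step//.
by rewrite !big_cons big_nil /with_ancestor /= !mul0e !add0e !adde0 mul1e.
Qed.

Lemma reach1 : reach ws 1.
Proof. by rewrite /reach BS_ancestor//; exact: reach0. Qed.

(** Serves both kinds of conditioning in the theorem: any event of positive probability that forces
    a parent of type [l] provides a word on which the type occurs. *)
Lemma occurring_formulas i (l : 'I_9) (E : set T) (Psi : pred (seq int)) :
  i <= 0 -> measurable E ->
  (forall t s, block 0 s -> cylinder X 0 s t -> E t <-> Psi (0 :: s)) ->
  (forall q, Psi q -> l \in exc_types i 1 q) ->
  (0 < P 0 E)%E -> offspring_formulas w f i l (law ws i l).
Proof.
move=> i0 mE EPsi Psil; rewrite (P_path w_env X_walk X_limsup mE EPsi).
move=> /esum_gt0[|q /= bq]; first by move=> q _; rewrite mule_ge0 ?weight_ge0E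
  ?indic_ge0.
have [Pq|] := boolP (Psi q); last by rewrite mule0 ltxx.
rewrite mule1 lte_fin => wq.
have [m0 rx wl] := occurring_type ws_env i0 reach1 bq wq (Psil q Pq).
have hB : (l %/ 3)%N = 1%N -> i + 1 <= 0 /\ 0 < ws (i + 1) (-2).
  move=> l3; move: wl; rewrite /fstep l3 /= (_ : i - 1 - (i + 1) = -2); last
    lia.
  (* At [i = 0] the parent would be the ancestor, whose step by -2 has weight 0. *)
  move=> wl; split=> //; rewrite leNgt; apply/negP => i1.
  have iz : i = 0 by lia.
  by move: wl; rewrite iz /with_ancestor /= ltxx.
apply: formulas_with_ancestor => //; first by move=> /hB[].
by apply: law_formulas => //; exact: hitting_exit_mass.
Qed.

Lemma branching_step i (E : set T) (Phi : pred (seq int)) (u v : 'rV[nat]_9) :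
  i <= 0 -> measurable E -> skeletal i Phi ->
  (forall t s, block 0 s -> cylinder X 0 s t -> E t <-> Phi (0 :: s)) ->
  (forall q, Phi q -> exc_count i 1 q = u) ->
  P 0 ([set t | U i t = v] `&` E) = (P 0 E * offspring_sum_law (law ws i) u
    v)%E.
Proof.
move=> i0 mE sk EPhi Phiu.
have mU := measurable_U X_walk i v.
rewrite (P_path w_env X_walk X_limsup mE EPhi).
rewrite (@P_path _ _ _ _ _ _ w_env X_walk X_limsup _
  (fun q => Phi q && (exc_count (i - 1) 1 q == v)) (measurableI _ _ mU mE));
    last first.
  move=> t s bs cs /=; have := @U_word _ _ X (i - 1) s t; rewrite subrK => ->
    //; last lia.
  split=> [[/eqP -> /(EPhi _ _ bs cs) ->]//|/andP[/(EPhi _ _ bs cs) Et /eqP]].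
  by split.
transitivity (block_sum ws 0 1 (fun q => indic (Phi q) * indic (exc_count (i -
  1)%R 1%R q == v))%E).
  by apply: eq_BS => // q _ _; case: (Phi q); rewrite /= ?mul1e ?mul0e.
rewrite (@BS_branching _ ws ws_env i 0 1 (fun q => indic (Phi q)) (fun a =>
  indic (a == v)))//.
- rewrite muleC -BSZ//; last 2 first.
  + apply: esum_ge0 => x _; rewrite lee_fin; apply: prodr_ge0 => k _.
    exact: law_ge0.
  + by move=> s; exact: indic_ge0.
  apply: eq_BS => // q _ _; case: (boolP (Phi q)) => [Pq|]; last by rewrite
    mule0 mul0e.
  rewrite mule1 mul1e -(Phiu q Pq) -offspring_sum_lawE//; exact: law_ge0.
- by move=> q1 x s q2 e xc bs es; rewrite (sk _ _ _ _ _ xc bs es).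
- by move=> q; exact: indic_ge0.
- by move=> a; exact: indic_ge0.
Qed.

Lemma skeletal_exc_count i j (v : 'rV[nat]_9) : i <= j -> skeletal i (fun q =>
  exc_count j 1 q == v).
Proof.
move=> ij q1 x s q2 e xc bs es; congr (_ == _); apply/rowP => l.
by rewrite !mxE (skeletal_exc_types 1 ij _ _ xc bs es).
Qed.

Lemma U_delta i (v : 'rV[nat]_9) t s : i <= 0 -> block 0 s -> cylinder X 0 s t
  ->
  [set t | U (i + 1) t = v] t <-> exc_count i 1 (0 :: s) == v.
Proof. by move=> i0 bs cs /=; rewrite (U_word i0 bs cs); split=> /eqP. Qed.

Lemma cprob_law i (l : 'I_9) v : i <= 0 ->
  (0 < P 0%R [set t | U (i + 1)%R t = delta_mx ord0 l])%E ->
  cprob (P 0) [set t | U i t = v] [set t | U (i + 1) t = delta_mx ord0 l] =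
  law ws i l v.
Proof.
move=> i0; set E := [set t | _ = delta_mx _ _] => PE.
have mE : measurable E := measurable_U X_walk _ _.
rewrite /cprob (@branching_step i E (fun q => exc_count i 1 q == delta_mx ord0
  l) (delta_mx ord0 l))//.
- rewrite delta_count_mem offspring_sum_lawE; last exact: law_ge0.
  rewrite compound1 (eq_esum (b := fun a => if v == a then (law ws i l a)%:E
    else 0%E)).
    rewrite (@esum_pick _ _ v (fun a => (law ws i l a)%:E)); last first.
      by move=> a; rewrite lee_fin law_ge0.
    have fin := fin_num_measure (P 0) _ mE.
    by rewrite fineM//= [X in X / _]mulrC mulfK// fine_eq0// gt_eqF.
  by move=> a _; rewrite eq_sym; case: eqP; rewrite ?mule1 ?mule0.
- exact: skeletal_exc_count.
- by move=> t s; exact: U_delta.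
- by move=> q /eqP.
Qed.

Lemma branching_process_law :
  branching_process (P 0) (fun n : nat => U (1 - n%:Z)) (fun n : nat => law ws
    (- n%:Z)).
Proof.
have nat0 (n : nat) : - n%:Z <= 0 by lia.
have UE (n : nat) : 1 - n%:Z = - n%:Z + 1 by rewrite addrC.
split.
- by move=> n v; exact: measurable_U X_walk _ _.
- by move=> n l; split; [exact: law_ge0|exact: esum_law].
- move=> n h v; set E := history _ n h => PE.
  have mE : measurable E.
    have -> : E = \bigcap_(k in [set k | (k <= n)%N]) [set t | U (1 - k%:Z) t =
      h k].
      by apply/seteqP; split=> t H k; exact: H.
    by apply: bigcap_measurable => [|k _]; [exists 0%N|exact: measurable_U
      X_walk _ _].
  (* The history up to generation [n] concerns only barriers from [-n] upwards, so it is skeletal at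
     [-n]. *)
  pose Phi q := all (fun k : nat => exc_count (- k%:Z) 1 q == h k) (iota 0
    n.+1).
  have iE : 1 - n.+1%:Z = - n%:Z by lia.
  have skPhi : skeletal (- n%:Z) Phi.
    move=> q1 x s q2 e xc bs es; apply: eq_in_all => k; rewrite mem_iota =>
      /andP[_ kn].
    have nk : - n%:Z <= - k%:Z by lia.
    exact: (skeletal_exc_count (h k) nk q1 q2 xc bs es).
  have EPhi t s : block 0 s -> cylinder X 0 s t -> E t <-> Phi (0 :: s).
    move=> bs cs; split=> [Et|/allP Pq k kn].
      apply/allP => k; rewrite mem_iota => /andP[_ kn].
      by apply/(U_delta _ (nat0 k) bs cs); rewrite -UE; exact: Et.
    rewrite UE; apply/(U_delta _ (nat0 k) bs cs); apply: Pq.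
    by rewrite mem_iota.
  have Phih q : Phi q -> exc_count (- n%:Z) 1 q = h n.
    by move=> /allP Pq; apply/eqP/Pq; rewrite mem_iota /=.
  have step := branching_step v (nat0 n) mE skPhi EPhi Phih.
  (* Finiteness of the product, with [P 0 E] positive, excludes infinite values of the offspring
     law, so the quotient of real numbers recovers it. *)
  have : (P 0 E * offspring_sum_law (law ws (- n%:Z)) (h n) v)%E \is a fin_num.
    by rewrite -step; apply: fin_num_measure; exact: measurableI (measurable_U
      X_walk _ _) mE.
  rewrite /cprob /preimage iE step; move: PE.
  have -> : P 0 E = (fine (P 0 E))%:E by rewrite fineK//; exact:
    fin_num_measure.
  case: (offspring_sum_law _ _ _) => [y| |] r0.
  - by rewrite /= mulrAC divff ?mul1r ?gt_eqF.
  - by rewrite fin_numE gt0_muley ?eqxx ?andbF.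
  - by rewrite fin_numE gt0_muleNy.
- move=> n l v; rewrite UE => PE; rewrite -cprob_law//.
  by congr cprob; rewrite (_ : 1 - n.+1%:Z = - n%:Z)//; lia.
Qed.

Lemma immigration k : (k < 3)%N ->
  fine (P 0 [set t | U 1 t = unit9 k]) = exit_mass ws 0 0 k.
Proof.
move=> k3; have mE := measurable_U X_walk 1 (unit9 k).
rewrite (@P_path _ _ _ _ _ _ w_env X_walk X_limsup _ (fun q => exc_count 0 1 q
  == unit9 k) mE).
  rewrite BS_ancestor; last by move=> s; exact: indic_ge0.
  congr fine; apply: eq_BS => // s bs _; congr indic.
  have [fk lk] := @fstep_lstep_inord 0 0 k isT k3.
  rewrite mul0n add0n /= add0r in fk lk.
  have tE : exc_types 0 1 (0 :: s) = exc_type 0 (1, 0) (exit_step 0 0 s).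
    by rewrite /= (exc_types_block _ bs)// cats0.
  apply/eqP/eqP => [/rowP/(_ (inord k))|es].
    rewrite /exc_count tE !mxE count_exc_type fk !eqxx /=.
    by case: eqP.
  rewrite /exc_count tE es -fk exc_type_step /unit9 delta_count_mem.
  by [].
move=> t s bs cs; rewrite -[1]add0r; exact: U_delta.
Qed.

Lemma immigration_formulas :
  [/\ exit_mass ws 0 0 0 = w 0 1 / d_ w f 1, exit_mass ws 0 0 2 = w 0 2 / d_ w
    f 1
    & exit_mass ws 0 0 1 = (d_ w f 1 - w 0 1 - w 0 2) / d_ w f 1].
Proof.
have dE : d_ w f 1 = 1 - ret ws 0.
  by rewrite -d_with_ancestor// (d_E hitting_exit_mass)// subrr.
have d0 : d_ w f 1 != 0 by rewrite dE ret_neq1//; exact: reach0.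
have e0 : exit_mass ws 0 0 0 = w 0 1 / d_ w f 1.
  apply: (mulIf d0); rewrite divfK// dE exit_mass_linear// /base /= mulr1.
  by rewrite with_ancestorE.
have e2 : exit_mass ws 0 0 2 = w 0 2 / d_ w f 1.
  apply: (mulIf d0); rewrite divfK// dE exit_mass_linear// /base /= mulr1.
  by rewrite with_ancestorE.
split=> //; have := reach_exits ws_env (lexx 0) (lexx 0) reach0.
rewrite e0 e2; move: (d_ w f 1) d0 => D D0 h.
have -> : exit_mass ws 0 0 1 = 1 - w 0 1 / D - w 0 2 / D by rewrite -h; ring.
by field.
Qed.

End Main.

Theorem theorem1p2 (R : realType) (d : measure_display) (T : measurableType d)
    (w : int -> int -> R) (P : int -> probability T R) (X : nat -> T -> int)
    (f := hitting_prob P X) (U := excursion_counts X)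
    (w_env : environment w)
    (X_walk : random_walk w P X)
    (X_limsup :
      {ae P 0, forall t, limn_esup (fun n => ((X n t)%:~R : R)%:E) = +oo%E}) :
  [/\ exists p : int -> 'I_9 -> 'rV[nat]_9 -> R,
        branching_process (P 0) (fun n : nat => U (1 - n%:Z))
          (fun n : nat => p (- n%:Z)) /\
        (forall (i : int) (l : 'I_9), i <= 0 ->
          (0 < P 0%R [set t | (0 < U (i + 1)%R t ord0 l)%N])%E ->
          offspring_formulas w f i l (p i l)),
      [/\ fine (P 0 [set t | U 1 t = row9 [:: 1; 0; 0; 0; 0; 0; 0; 0; 0]%N]) =
            w 0 1 / d_ w f 1,
          fine (P 0 [set t | U 1 t = row9 [:: 0; 0; 1; 0; 0; 0; 0; 0; 0]%N]) =
            w 0 2 / d_ w f 1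
        & fine (P 0 [set t | U 1 t = row9 [:: 0; 1; 0; 0; 0; 0; 0; 0; 0]%N]) =
            (d_ w f 1 - w 0 1 - w 0 2) / d_ w f 1]
    & forall (i : int) (l : 'I_9), i <= 0 ->
        (0 < P 0%R [set t | U (i + 1)%R t = delta_mx ord0 l])%E ->
        offspring_formulas w f i l
          (fun v => cprob (P 0) [set t | U i t = v]
                          [set t | U (i + 1) t = delta_mx ord0 l])].
Proof.
have unit_row k s : size s = 9%N -> (k < 9)%N -> nth 0%N s k = 1%N ->
    all (pred1 0%N) (set_nth 0%N s k 0) -> row9 s = unit9 k.
  move=> s9 k9 sk s0; apply/esym/eqP; rewrite -[unit9 k]addr0 unit9D_row9// sk.
  by rewrite eq0_row9// size_set_nth s9; apply/maxn_idPr.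
split.
- exists (law (with_ancestor w)); split; first exact: branching_process_law.
  move=> i l i0; set E := [set t | _].
  apply: (@occurring_formulas _ _ _ _ _ _ w_env X_walk X_limsup i l E
    (fun q => (0 < exc_count i 1 q ord0 l)%N)) => //.
  + have -> : E = \bigcup_(v in [set v : 'rV[nat]_9 | (0 < v ord0 l)%N])
        [set t | U (i + 1) t = v].
      apply/seteqP; split=> [t Et|t [v vl /= tv]]; first by exists (U (i + 1)
        t).
      by rewrite /E /= tv.
    by apply: measurable_bigcup_count => v _; exact: measurable_U X_walk _ _.
  + by move=> t s bs cs; rewrite /E /= /U (U_word i0 bs cs).
  + by move=> q; rewrite mxE -has_count has_pred1.
- have [e0 e2 e1] := immigration_formulas w_env X_walk X_limsup.
  split; [rewrite (unit_row 0%N)//|rewrite (unit_row 2%N)//|rewrite (unit_row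
    1%N)//];
    by rewrite (immigration w_env X_walk X_limsup).
- move=> i l i0; set E := [set t | _] => PE.
  have -> : (fun v => cprob (P 0) [set t | U i t = v] E) = law (with_ancestor
    w) i l.
    by apply/funext => v; exact: (cprob_law w_env X_walk X_limsup v i0 PE).
  apply: (@occurring_formulas _ _ _ _ _ _ w_env X_walk X_limsup i l E
    (fun q => exc_count i 1 q == delta_mx ord0 l)) => //.
  + exact: measurable_U X_walk _ _.
  + by move=> t s; exact: U_delta.
  + move=> q /eqP/rowP/(_ l); rewrite !mxE !eqxx => ql.
    by rewrite -has_pred1 has_count ql.
Qed.
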